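(* Let $K$ be a field, $S=K[x_1,\ldots,x_n]$, let $I\subset S$ be a monomial ideal, and let $(\alpha,\beta)$ with $\alpha,\beta\in\mathbb{N}^n$ be a covering pair for $I$, i.e. $I=I^{\leq\alpha}+I^{\leq\beta}$. Suppose that $p=\operatorname{proj\,dim} S/I^{\leq\alpha}$ and $q=\operatorname{proj\,dim} S/I^{\leq\beta}$. Then $\operatorname{proj\,dim} S/I\leq p+q$, and for all integers $a\leq \operatorname{proj\,dim} S/I$ we have $$t_a(I)\leq \max\{t_i(I)+t_j(I) : i+j=a,\ i\leq p,\ j\leq q\}.$$
   Context: $S=K[x_1,\ldots,x_n]$ is the polynomial ring over a field $K$ with the standard grading ($\deg x_i=1$), and $\mathbb{N}$ includes $0$. For the graded minimal free $S$-resolution $\mathbb{F}$ of $S/I$ write $\mathbb{F}_a=\bigoplus_j S(-j)^{b_{aj}}$ and set $t_a(I)=\max\{j : b_{aj}\neq 0\}$, the maximal degree of a homogeneous basis element of $\mathbb{F}_a$. If $\mathbb{F}_a=0$ (in particular for $a<0$), the convention is $t_a(I)=-\infty$. Indexing: $\mathbb{F}$ resolves $S/I$, so $\mathbb{F}_0=S$ (for $I$ proper) and $t_1(I)$ is the maximal degree of a minimal generator of $I$. For a monomial ideal $I$ and $\alpha\in\mathbb{N}^n$, $I^{\leq\alpha}$ denotes the monomial ideal generated by all monomials $x^{b}=x_1^{b_1}\cdots x_n^{b_n}\in I$ with $b\leq\alpha$ componentwise. A pair $(\alpha,\beta)$ of vectors in $\mathbb{N}^n$ is called a covering pair for $I$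 if $I=I^{\leq\alpha}+I^{\leq\beta}$. *)

(* Defs.v *)
From HB Require Import structures.
From mathcomp Require Import all_boot all_order all_algebra.
(* mpoly has to be imported before constructive_ereal: their notation levels
   are incompatible in the other order. *)
From mathcomp Require Import mpoly.
From mathcomp Require Import boolp constructive_ereal.

Set Implicit Arguments.
Unset Strict Implicit.
Unset Printing Implicit Defensive.

Import Order.TTheory GRing.Theory Num.Theory.
Local Open Scope ring_scope.

(* The library's [idealr] is boolean and excludes the unit ideal; here ideals
   are Prop-valued and possibly improper. *)
Record ideal (R : comNzRingType) := Ideal {
  ideal_mem :> R -> Prop;
  ideal_mem0 : ideal_mem 0;
  ideal_memD : forall x y, ideal_mem x -> ideal_mem y -> ideal_mem (x + y);
  ideal_memM : forall a x, ideal_mem x -> ideal_mem (a * x) }.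

Section Ideals.
Variable R : comNzRingType.

Definition ideal_eq (I J : ideal R) : Prop := forall x, I x <-> J x.

Section Sum.
Variables I J : ideal R.
Let mem (x : R) : Prop := exists y z, [/\ I y, J z & x = y + z].

Fact ideal_add0 : mem 0.
Proof. by exists 0, 0; split; [exact: ideal_mem0|exact: ideal_mem0|rewrite addr0]. Qed.

Fact ideal_addD x y : mem x -> mem y -> mem (x + y).
Proof.
move=> [a [b [Ia Jb ->]]] [c [e [Ic Je ->]]]; exists (a + c), (b + e).
by split; [exact: ideal_memD|exact: ideal_memD|rewrite addrACA].
Qed.

Fact ideal_addM a x : mem x -> mem (a * x).
Proof.
move=> [b [c [Ib Jc ->]]]; exists (a * b), (a * c).
by split; [exact: ideal_memM|exact: ideal_memM|rewrite mulrDr].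
Qed.

Definition ideal_add : ideal R := Ideal ideal_add0 ideal_addD ideal_addM.
End Sum.

Section Generated.
Variable A : R -> Prop.
Let mem (x : R) : Prop := forall J : ideal R, (forall y, A y -> J y) -> J x.

Fact ideal_gen0 : mem 0. Proof. by move=> J _; exact: ideal_mem0. Qed.

Fact ideal_genD x y : mem x -> mem y -> mem (x + y).
Proof. by move=> hx hy J hJ; apply: ideal_memD; [exact: hx|exact: hy]. Qed.

Fact ideal_genM a x : mem x -> mem (a * x).
Proof. by move=> hx J hJ; apply: ideal_memM; exact: hx. Qed.

Definition ideal_gen : ideal R := Ideal ideal_gen0 ideal_genD ideal_genM.
End Generated.

Definition ideal_pred (I : ideal R) : {pred R} := fun x => `[< I x >].

Fact ideal_pred_zmod_closed (I : ideal R) : zmod_closed (ideal_pred I).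
Proof.
split=> [|x y]; first exact/asboolP/ideal_mem0.
move=> /asboolP Ix /asboolP Iy; apply/asboolP/ideal_memD => //.
by rewrite -mulN1r; exact: ideal_memM.
Qed.

HB.instance Definition _ (I : ideal R) :=
  GRing.isZmodClosed.Build R (ideal_pred I) (ideal_pred_zmod_closed I).

Definition quotmod (I : ideal R) : Type := Quotient.quot (ideal_pred I).

HB.instance Definition _ (I : ideal R) := GRing.Zmodule.on (quotmod I).

Definition quotmod_pi (I : ideal R) (x : R) : quotmod I :=
  \pi_(Quotient.quot (ideal_pred I))%qT x.

Section QuotientModule.
Variable I : ideal R.
Local Notation pi := (quotmod_pi I).

Definition quotmod_repr (u : quotmod I) : R :=
  repr (u : Quotient.quot (ideal_pred I)).

Definition quotmod_scale (a : R) (u : quotmod I) : quotmod I :=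
  pi (a * quotmod_repr u).

Fact quotmod_reprK u : pi (quotmod_repr u) = u.
Proof. exact: reprK. Qed.

Fact quotmod_piP x y : pi x = pi y <-> I (x - y).
Proof.
rewrite /quotmod_pi; split=> [/eqP|Ixy].
  by rewrite -Quotient.idealrBE => /asboolP.
by apply/eqP; rewrite -Quotient.idealrBE; apply/asboolP.
Qed.

Fact quotmod_piD x y : pi (x + y) = pi x + pi y.
Proof. exact: (raddfD (\pi_(Quotient.quot (ideal_pred I))%qT)). Qed.

Fact quotmod_piM a x : quotmod_scale a (pi x) = pi (a * x).
Proof.
apply/quotmod_piP; rewrite -mulrBr; apply: ideal_memM.
by apply/quotmod_piP; rewrite quotmod_reprK.
Qed.

Fact quotmod_scaleA a b u :
  quotmod_scale a (quotmod_scale b u) = quotmod_scale (a * b) u.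
Proof. by rewrite -[u]quotmod_reprK !quotmod_piM mulrA. Qed.

Fact quotmod_scale1 : left_id 1 quotmod_scale.
Proof. by move=> u; rewrite -[u]quotmod_reprK quotmod_piM mul1r. Qed.

Fact quotmod_scaleDr : right_distributive quotmod_scale +%R.
Proof.
move=> a u v; rewrite -[u]quotmod_reprK -[v]quotmod_reprK.
by rewrite -quotmod_piD !quotmod_piM mulrDr quotmod_piD.
Qed.

Fact quotmod_scaleDl u : {morph quotmod_scale^~ u : a b / a + b}.
Proof.
by move=> a b; rewrite -[u]quotmod_reprK !quotmod_piM mulrDl quotmod_piD.
Qed.

HB.instance Definition _ := GRing.Zmodule_isLmodule.Build R (quotmod I)
  quotmod_scaleA quotmod_scale1 quotmod_scaleDr quotmod_scaleDl.

End QuotientModule.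

End Ideals.

Section ProjectiveDimension.
Variable R : nzRingType.

Definition projective (P : lmodType R) : Prop :=
  forall (M N : lmodType R) (f : {linear M -> N}) (g : {linear P -> N}),
    (forall y, exists x, f x = y) ->
  exists h : {linear P -> M}, forall x, f (h x) = g x.

Record is_resolution (M : lmodType R) (P : nat -> lmodType R)
    (d : forall a, {linear P a.+1 -> P a}) (eps : {linear P 0 -> M}) : Prop := {
  resolution_surj : forall y, exists x, eps x = y;
  resolution_exact0 : forall x, eps x = 0 <-> exists y, x = d 0 y;
  resolution_exactS : forall a x, d a x = 0 <-> exists y, x = d a.+1 y }.

Definition has_projective_resolution (M : lmodType R) (l : nat) : Prop :=
  exists (P : nat -> lmodType R) (d : forall a, {linear P a.+1 -> P a})
         (eps : {linear P 0 -> M}),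
    [/\ forall a, projective (P a), is_resolution d eps &
        forall a, (l < a)%N -> forall x : P a, x = 0].

(* The least length of a projective resolution, +oo if there is none; by
   convention the zero module has projective dimension -oo (not 0 or -1). *)
Definition projdim (M : lmodType R) : \bar int :=
  if `[< forall x : M, x = 0 >] then -oo%E else
  if pselect (exists l, `[< has_projective_resolution M l >]) is left ex
  then ((ex_minn ex)%:Z)%:E else +oo%E.

End ProjectiveDimension.

Section MonomialIdeals.
Variables (K : fieldType) (n : nat).
Local Notation S := {mpoly K[n]}.

Definition monomial_ideal (I : ideal S) : Prop :=
  exists A : 'X_{1..n} -> Prop,
    ideal_eq I (ideal_gen (fun f => exists2 b, A b & f = 'X_[b])).

(* [(b <= alpha)%MM] is the componentwise order on exponent vectors. *)
Definition ideal_le (I : ideal S) (alpha : 'X_{1..n}) : ideal S :=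
  ideal_gen (fun f => exists b, [/\ I 'X_[b], (b <= alpha)%MM & f = 'X_[b]]).

Definition covering_pair (I : ideal S) (alpha beta : 'X_{1..n}) : Prop :=
  ideal_eq I (ideal_add (ideal_le I alpha) (ideal_le I beta)).

Definition homogeneous (z : int) (f : S) : Prop :=
  f = 0 \/ exists2 e : nat, z = e%:Z & f \is e.-homog.

(* F_a is the free module of row vectors of length [mgr_rank a], the k-th basis
   vector having degree [mgr_deg a k]; that is, F_a is the direct sum of the
   S(-mgr_deg a k). The differential is right multiplication by [mgr_diff a].
   Minimality: the differential maps F_(a+1) into (x_1, ..., x_n) F_a. *)
Record min_graded_resolution (I : ideal S) := MinGradedResolution {
  mgr_rank : nat -> nat;
  mgr_deg : forall a, 'I_(mgr_rank a) -> int;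
  mgr_diff : forall a, 'M[S]_(mgr_rank a.+1, mgr_rank a);
  mgr_aug : {linear 'rV[S]_(mgr_rank 0) -> quotmod I};
  mgr_resolution :
    @is_resolution S (quotmod I) (fun a => 'rV[S]_(mgr_rank a))
      (fun a => mulmxr (mgr_diff a)) mgr_aug;
  mgr_diff_homog : forall a k l,
    homogeneous (mgr_deg k - mgr_deg l) (mgr_diff a k l);
  mgr_aug_homog : forall k, exists2 f,
    homogeneous (mgr_deg k) f & mgr_aug (delta_mx 0 k) = quotmod_pi I f;
  mgr_minimal : forall a k l, (mgr_diff a k l)@_0%MM = 0 }.

(* The largest j such that S(-j) is a summand of F_a; the empty maximum is -oo. *)
Definition t_ (I : ideal S) (F : min_graded_resolution I) (a : int) : \bar int :=
  match a with
  | Posz m => \big[maxe/-oo%E]_(k < mgr_rank F m) (mgr_deg k)%:E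
  | Negz _ => -oo%E
  end.

End MonomialIdeals.

Definition is_maximum (A : \bar int -> Prop) (m : \bar int) : Prop :=
  A m /\ forall x, A x -> (x <= m)%E.

(* Main.v *)
Require Import Defs.
From HB Require Import structures.
From mathcomp Require Import all_boot all_order all_algebra.
From mathcomp Require Import zify.
From mathcomp Require Import mpoly.
From mathcomp Require finmap monalg.
From mathcomp Require Import boolp constructive_ereal.

Set Implicit Arguments.
Unset Strict Implicit.
Unset Printing Implicit Defensive.

Import Order.TTheory GRing.Theory Num.Theory.
Local Open Scope ring_scope.

(** Throughout, resolutions are replaced by Koszul homology, in each degree
    separately.  Write H_i(M)_b for the homology of the Koszul complex of the
    variables with coefficients in the graded module M, in homological degree
    i and internal degree b.  Only the vanishing of these groups matters;
    [exact_at] is that vanishing.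

    The link with the statement is dimension shifting along a resolution.  A
    projective resolution of length l of M gives H_i(M) = 0 for i > l
    ([projective_resolution_exact]), and the a-th module of the minimal graded
    resolution of S/I has a generator of degree j exactly when H_a(S/I) does
    not vanish in total degree j ([generator_exact]).  For a monomial ideal the
    Koszul complex splits into its strands of multidegree b, and
    H_(a+1)(S/I)_b = H_a(I)_b; the strand in degree b only sees which monomials
    x^(b-sigma), with sigma a set of variables, lie in I.  Hence I and its part
    below alpha have the same strands in the degrees c <= alpha
    ([exact_ideal_le]), and in any other degree the strand of the part below
    alpha is acyclic, because some variable acts on it bijectively
    ([exact_ideal_le_vanish]).  A nonzero H_i(J)_c, where J is the part below
    alpha, therefore yields both a generator of degree |c| in homological
    degree i+1 of the resolution of S/I, and i+1 <= p
    ([restricted_generator]).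

    It remains to bound the homology of a sum J + L of monomial ideals.  By
    Mayer-Vietoris a class in degree b comes from J, from L, or, one homological
    degree lower, from the intersection of J and L ([exact_union]).  For the
    intersection the claim is that H_m of it in degree b vanishes unless there
    are i + j = m and c, d with join b such that H_i(J)_c and H_j(L)_d are both
    nonzero ([exact_restr]).  Two such classes give |b| <= |c| + |d| and
    homological degrees (i+1) + (j+1) = m+2 for S/I, which is the asserted
    inequality.  A class of J or of L alone is paired with the generator of
    degree 0 in homological degree 0 ([generator_split]).

    The claim on the intersection is proved with L replaced by an arbitrary
    increasing family B of finite-dimensional vector spaces, by induction on m.
    Take the minimal free cover P of B, with kernel B'.  Restricting to the
    degrees in J is exact.  The restriction of P is a direct sum of truncations
    of J to the degrees above a generator d of P, and a class of such a
    truncation in degree b comes from a class of J in a degree c with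
    join(c, d) = b ([exact_trunc]), while H_0(B)_d is nonzero.  The restriction
    of B' is handled by induction, since H_j(B')_d is isomorphic to
    H_(j+1)(B)_d by minimality of the cover.  This is the homological shadow of
    the complex that Herzog builds from resolutions of S/J and S/L by taking
    joins of degrees.

    The bound on the projective dimension is the same inequality read in
    homological degrees: a generator in degree a forces a <= p + q, so the given
    minimal resolution already has length at most p + q. *)

(** * Koszul complexes as iterated cones *)

Definition morphB (T T' : zmodType) (f : T -> T') : Prop :=
  {morph f : u v / u - v}.

Section MorphB.
Variables (T T' : zmodType) (f : T -> T').
Hypothesis fB : morphB f.

Lemma morphB0 : f 0 = 0. Proof. by rewrite -{1}(subrr 0) fB subrr. Qed.
Lemma morphBN u : f (- u) = - f u.
Proof. by rewrite -sub0r fB morphB0 sub0r. Qed.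
Lemma morphBD u v : f (u + v) = f u + f v.
Proof. by rewrite -[v in LHS]opprK fB morphBN opprK. Qed.
Lemma morphB_sum (A : Type) (r : seq A) (F : A -> T) :
  f (\sum_(i <- r) F i) = \sum_(i <- r) f (F i).
Proof. exact: (big_morph f morphBD morphB0). Qed.
End MorphB.

Section Koszul.
Variables (I : eqType) (G : zmodType) (e : I -> G).

(** The Koszul complex on the operators listed in [s], as an iterated mapping
    cone: one cone per operator, so that a chain is a binary tree of elements
    of [T] and the only signs are those of the cone differential. *)
Fixpoint kos (T : zmodType) (s : seq I) : zmodType :=
  if s is _ :: s' then (kos T s' * kos T s')%type else T.

(** The map [f] may depend on the degree, which is needed for maps such as the
    extraction of a coefficient. *)
Fixpoint kmap (T T' : zmodType) (f : G -> T -> T') (s : seq I) :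
    G -> kos T s -> kos T' s :=
  if s is k :: s' then
    fun g u => (kmap f g u.1, kmap f (g - e k) u.2)
  else f.

Fixpoint kd (T : zmodType) (x : I -> T -> T) (s : seq I) :
    kos T s -> kos T s :=
  if s is k :: s' then
    fun u => (kd x u.1 + kmap (fun=> x k) 0 u.2, - kd x u.2)
  else fun=> 0.

(** A graded module is a family of subgroups of one ambient group [T]; [X g u]
    says that [u] is in the part of degree [g]. *)
Definition gfam (T : zmodType) := G -> T -> Prop.

(** Passing to the second summand of the cone over [k] lowers the internal
    degree by [e k] and the homological degree by one.  The homological degree
    is an integer, so that the bottom of the complex is not a special case. *)
Fixpoint kmem (T : zmodType) (X : gfam T) (s : seq I) :
    G -> int -> kos T s -> Prop :=
  if s is k :: s' then
    fun g i u => kmem X g i u.1 /\ kmem X (g - e k) (i - 1) u.2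
  else fun g i u => X g u /\ (i != 0 -> u = 0).

Definition exact_at (T : zmodType) (x : I -> T -> T) (X : gfam T) (s : seq I)
    (g : G) (i : int) : Prop :=
  forall u : kos T s, kmem X g i u -> kd x u = 0 ->
  exists2 w : kos T s, kmem X g (i + 1) w & kd x w = u.

Definition subgrp (T : zmodType) (X : gfam T) : Prop :=
  forall g, X g 0 /\ (forall u v, X g u -> X g v -> X g (u - v)).

Definition stable (T : zmodType) (x : I -> T -> T) (X : gfam T) : Prop :=
  forall g k u, X (g - e k) u -> X g (x k u).

Definition ops (T : zmodType) (x : I -> T -> T) : Prop :=
  (forall k, morphB (x k)) /\ (forall k l u, x k (x l u) = x l (x k u)).

Lemma subgrpD (T : zmodType) (X : gfam T) g u v : subgrp X ->
  X g u -> X g v -> X g (u + v).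
Proof.
move=> /(_ g) [X0 XB] Xu Xv; rewrite -[v]opprK; apply: (XB) => //.
by rewrite -sub0r; exact: XB.
Qed.

Lemma subgrp_sum (T : zmodType) (X : gfam T) g (A : Type) (r : seq A)
    (F : A -> T) : subgrp X -> (forall a, X g (F a)) -> X g (\sum_(a <- r) F a).
Proof.
move=> sX XF; elim/big_ind: _ => //; first by case: (sX g).
by move=> u v; exact: subgrpD.
Qed.

(** The degrees of the entries of a chain of degree [g] are the [g - d] with
    [d] a shift. *)
Definition shift (d : G) : Prop := exists r : seq I, d = \sum_(k <- r) e k.

Lemma shift0 : shift 0. Proof. by exists [::]; rewrite big_nil. Qed.

Lemma shiftS d k : shift d -> shift (e k + d).
Proof. by move=> [r ->]; exists (k :: r); rewrite big_cons. Qed.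

Section Map.
Variables (T T' : zmodType).
Implicit Type f : G -> T -> T'.

Lemma kmapB f s g : (forall h, morphB (f h)) -> morphB (@kmap T T' f s g).
Proof.
move=> fB; elim: s g => [|k s IH] g u v /=; first exact: fB.
by rewrite !IH.
Qed.

Lemma eq_kmap f f' s g h (u : kos T s) :
  (forall d v, f (g - d) v = f' (h - d) v) -> kmap f g u = kmap f' h u.
Proof.
elim: s g h u => [|k s IH] g h u E /=.
  by have := E 0 u; rewrite !subr0.
congr pair; first exact: IH.
by apply: IH => d v; rewrite -!addrA -!opprD.
Qed.

Lemma kmap_comp (T'' : zmodType) (f' : G -> T' -> T'') f s g (u : kos T s) :
  kmap f' g (kmap f g u) = kmap (fun h v => f' h (f h v)) g u.
Proof. by elim: s g u => [|k s IH] g u //=; rewrite !IH. Qed.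

Lemma kmapDf f f' s g (u : kos T s) :
  kmap (fun h v => f h v + f' h v) g u = kmap f g u + kmap f' g u.
Proof. by elim: s g u => [|k s IH] g u //=; rewrite !IH. Qed.

Lemma kmap0f s g (u : kos T s) : kmap (fun _ _ => 0 : T') g u = 0.
Proof. by elim: s g u => [|k s IH] g u //=; rewrite !IH. Qed.

Lemma kmap_sumf (A : Type) (r : seq A) (F : A -> G -> T -> T') s g
    (u : kos T s) :
  kmap (fun h v => \sum_(a <- r) F a h v) g u = \sum_(a <- r) kmap (F a) g u.
Proof.
elim: r => [|a r IH].
  rewrite big_nil -(kmap0f g u); apply: eq_kmap => d v; exact: big_nil.
rewrite big_cons -IH -kmapDf; apply: eq_kmap => d v; exact: big_cons.
Qed.

Lemma kmap_kmem f (X : gfam T) (X' : gfam T') s g h i (u : kos T s) :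
  (forall d, f (h - d) 0 = 0) ->
  (forall d v, X (g - d) v -> X' (h - d) (f (h - d) v)) ->
  kmem X g i u -> kmem X' h i (kmap f h u).
Proof.
elim: s g h i u => [|k s IH] g h i u f0 fX /=.
  have := fX 0; rewrite !subr0 => H [/H Xu ui]; split=> // /ui ->.
  by have := f0 0; rewrite subr0.
move=> [u1 u2]; split; first exact: (IH g).
apply: (IH (g - e k)) u2 => [d|d v]; rewrite -!addrA -!opprD.
- exact: f0.
- exact: fX.
Qed.

End Map.

Section One.
Variables (T : zmodType).
Implicit Types (x : I -> T -> T) (X : gfam T).

Lemma kmap_id_on f X s g h i (u : kos T s) : kmem X g i u ->
  (forall d v, shift d -> X (g - d) v -> f (h - d) v = v) -> kmap f h u = u.
Proof.
elim: s g h i u => [|k s IH] g h i u /=.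
  by move=> [Xu _] /(_ 0 u shift0); rewrite !subr0; apply.
move=> [u1 u2] E; rewrite (IH g _ i) // (IH (g - e k) _ (i - 1)) //.
  by case: u {u1 u2}.
by move=> d v sd; rewrite -!addrA -!opprD; apply: E; exact: shiftS.
Qed.

Lemma kmem_ext X X' s g h i (u : kos T s) :
  (forall d v, X (g - d) v -> X' (h - d) v) -> kmem X g i u -> kmem X' h i u.
Proof.
elim: s g h i u => [|k s IH] g h i u E /=.
  by have := E 0 u; rewrite !subr0 => H [/H ? ?].
move=> [u1 u2]; split; first exact: (IH g).
by apply: (IH (g - e k)) u2 => d v; rewrite -!addrA -!opprD; exact: E.
Qed.

Lemma kmem0 X s g i : subgrp X -> kmem X g i (0 : kos T s).
Proof.
move=> sX; elim: s g i => [|k s IH] g i //=.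
by split=> //; case: (sX g).
Qed.

Lemma kmemB X s g i (u v : kos T s) : subgrp X ->
  kmem X g i u -> kmem X g i v -> kmem X g i (u - v).
Proof.
move=> sX; elim: s g i u v => [|k s IH] g i u v /=.
  move=> [Xu ui] [Xv vi]; split=> [|i0].
    by case: (sX g) => _; exact.
  by rewrite (ui i0) (vi i0) subrr.
by move=> [u1 u2] [v1 v2]; split; apply: IH.
Qed.

Lemma kmemN X s g i (u : kos T s) : subgrp X ->
  kmem X g i u -> kmem X g i (- u).
Proof. by move=> sX Xu; rewrite -sub0r; apply: kmemB => //; exact: kmem0. Qed.

Lemma kmemD X s g i (u v : kos T s) : subgrp X ->
  kmem X g i u -> kmem X g i v -> kmem X g i (u + v).
Proof.
by move=> sX Xu Xv; rewrite -[v]opprK; apply: kmemB => //; exact: kmemN.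
Qed.

Lemma kmem_sum X s g i (A : Type) (r : seq A) (F : A -> kos T s) : subgrp X ->
  (forall a, kmem X g i (F a)) -> kmem X g i (\sum_(a <- r) F a).
Proof.
by move=> sX XF; elim/big_ind: _ => //; [exact: kmem0|move=> *; exact: kmemD].
Qed.

Lemma kmem_neg X s g i (u : kos T s) : kmem X g i u -> (i < 0)%R -> u = 0.
Proof.
elim: s g i u => [|k s IH] g i u /=;
  first by move=> [_ ui] /lt_eqF i0; apply: ui; rewrite i0.
move=> [u1 u2] i0; case: u u1 u2 => a b /= /IH -> // /IH -> //.
by apply: lt_trans i0; rewrite gtrBl.
Qed.

Lemma kdB x s : (forall k, morphB (x k)) -> morphB (@kd T x s).
Proof.
move=> xB; elim: s => [|k s IH] u v /=; first by rewrite subrr.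
rewrite !IH (@kmapB _ _ (fun=> x k)) //; congr pair; last exact: opprD.
by rewrite addrACA -opprD.
Qed.

Lemma kmap_kd (T' : zmodType) (x' : I -> T' -> T') (f : G -> T -> T') x s g
    (u : kos T s) :
  (forall h, morphB (f h)) ->
  (forall k h v, k \in s -> f h (x k v) = x' k (f (h - e k) v)) ->
  kmap f g (kd x u) = kd x' (kmap f g u).
Proof.
move=> fB; elim: s g u => [|k s IH] g u fx /=; first exact: (morphB0 (fB g)).
have IH' := IH _ _ (fun l h v ls => fx l h v (mem_behead (s := k :: s) ls)).
rewrite (morphBN (kmapB _ _)) // (morphBD (kmapB _ _)) // !IH'.
congr (_ + _, _).
rewrite (@eq_kmap _ _ (fun=> x k) (fun=> x k) s 0 g) //.
rewrite (@eq_kmap _ _ (fun=> x' k) (fun=> x' k) s 0 (g - e k)) // !kmap_comp.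
by apply: eq_kmap => d v; rewrite fx ?mem_head // addrAC.
Qed.

Lemma eq_kmap_on (T' : zmodType) (f f' : G -> T -> T') X s g g' h i
    (u : kos T s) : kmem X g i u ->
  (forall d v, X (g - d) v -> f (g' - d) v = f' (h - d) v) ->
  kmap f g' u = kmap f' h u.
Proof.
elim: s g g' h i u => [|k s IH] g g' h i u /=.
  by move=> [Xu _] /(_ 0 u); rewrite !subr0; apply.
move=> [u1 u2] E; congr pair; first exact: IH u1 _.
by apply: IH u2 _ => d v; rewrite -!addrA -!opprD; exact: E.
Qed.

Lemma kmap_kd_on (T' : zmodType) (x' : I -> T' -> T') (f : G -> T -> T') x X s
    g i (u : kos T s) :
  (forall h, morphB (f h)) -> kmem X g i u ->
  (forall k h v, X (h - e k) v -> f h (x k v) = x' k (f (h - e k) v)) ->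
  kmap f g (kd x u) = kd x' (kmap f g u).
Proof.
move=> fB; elim: s g i u => [|k s IH] g i u /=.
  by move=> _ _; exact: (morphB0 (fB g)).
move=> [u1 u2] fx.
rewrite (morphBN (kmapB _ _)) // (morphBD (kmapB _ _)) //.
rewrite (IH _ _ _ u1) // (IH _ _ _ u2) //; congr (_ + _, _).
rewrite (@eq_kmap _ _ (fun=> x k) (fun=> x k) s 0 g) //.
rewrite (@eq_kmap _ _ (fun=> x' k) (fun=> x' k) s 0 (g - e k)) // !kmap_comp.
by apply: eq_kmap_on u2 _ => d v; rewrite addrAC => /fx ->.
Qed.

Lemma kdK x s (u : kos T s) : ops x -> kd x (kd x u) = 0.
Proof.
move=> [xB xC]; elim: s u => [|k s IH] u //=.
rewrite (morphBD (kdB xB)) !(morphBN (kdB xB)) !IH oppr0.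
rewrite (morphBN (kmapB _ _)) // -(@kmap_kd _ x (fun=> x k) x) //.
by rewrite !add0r subrr oppr0.
Qed.

Lemma kmem_kd x X s g i (u : kos T s) : subgrp X -> (forall k, morphB (x k)) ->
  stable x X -> kmem X g i u -> kmem X g (i - 1) (kd x u).
Proof.
move=> sX xB xX; elim: s g i u => [|k s IH] g i u /=.
  by move=> _; split=> //; case: (sX g).
move=> [u1 u2]; split; last by apply: kmemN => //; exact: IH.
apply: kmemD; [by []|exact: IH|].
rewrite (@eq_kmap _ _ (fun=> x k) (fun=> x k) s 0 g) //.
apply: (kmap_kmem (X := X) (g := g - e k)) u2 => [d|d v].
  exact: (morphB0 (xB k)).
by rewrite addrAC; exact: xX.
Qed.

(** Chains of homological degree 0 are the elements of [T]; they sit at the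
    leftmost leaf of the tree. *)
Fixpoint kone s : T -> kos T s :=
  if s is k :: s' then fun u => (kone s' u, 0) else id.

Lemma koneB s : morphB (kone s).
Proof.
by elim: s => [|k s IH] u v //=; rewrite IH; congr pair; rewrite subrr.
Qed.

Lemma kmem0P X s g (z : kos T s) : subgrp X ->
  kmem X g 0 z <-> exists2 u, X g u & z = kone s u.
Proof.
move=> sX; elim: s g z => [|k s IH] g z /=.
  by split=> [[Xz _]|[u Xu ->]]; [exists z|].
split=> [|[u Xu ->] /=].
  case: z => z1 z2 /= [/IH [u Xu ->]] /kmem_neg -> //.
  by exists u.
split; last exact: kmem0.
by apply/IH; exists u.
Qed.

Lemma kd_kone x s u : (forall k, morphB (x k)) -> kd x (kone s u) = 0.
Proof.
move=> xB; elim: s => [|k s IH] //=.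
by rewrite IH (morphB0 (kmapB _ _)) // (morphB0 (kdB xB)) oppr0 addr0.
Qed.

End One.

Lemma kmap_kone (T T' : zmodType) (f : G -> T -> T') s g u :
  (forall h, morphB (f h)) -> kmap f g (kone s u) = kone s (f g u).
Proof.
move=> fB; elim: s g => [|k s IH] g //=.
by rewrite IH (morphB0 (kmapB _ _)).
Qed.

(** Degree-0 boundaries are the combinations of multiples of the operators, so
    homology in degree 0 is the module of generators. *)
Lemma kone_bound_out (T : zmodType) (x : I -> T -> T) (X : gfam T) s g u :
  subgrp X -> (forall k, morphB (x k)) -> uniq s ->
  (exists2 w : kos T s, kmem X g 1 w & kd x w = kone s u) ->
  exists2 y : I -> T, (forall k, X (g - e k) (y k)) &
    u = \sum_(k <- s) x k (y k).
Proof.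
move=> sX xB; elim: s u => [|k s IH] u /=.
  move=> _ [w _ <-]; exists (fun=> 0); last by rewrite big_nil.
  by move=> k; case: (sX (g - e k)).
move=> /andP[ks us] [[w1 w2] /= [Xw1 +] [+ _]].
rewrite subrr => /(@kmem0P _ _ _ _ _ sX) [yk Xyk ->].
rewrite kmap_kone // => dw.
have [|y Xy uE] := IH (u - x k yk) us.
  by exists w1 => //; rewrite (@koneB _ s) -dw addrK.
exists (fun l => if l == k then yk else y l).
  by move=> l; case: eqP => // ->.
rewrite big_cons eqxx -[LHS](subrK (x k yk)) uE addrC; congr (_ + _).
by apply: eq_big_seq => l ls; case: eqP => // lk; rewrite -lk ls in ks.
Qed.

End Koszul.

(** * Exactness criteria for Koszul complexes *)

Section KoszulExactness.
Variables (I : eqType) (G : zmodType) (e : I -> G).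
Local Notation gfam := (gfam G).
Local Notation exact_at := (exact_at e).

Section ShortExact.
Variables (P T : zmodType) (x : I -> P -> P) (x' : I -> T -> T) (f : P -> T).
Variables (Z Y : gfam P) (X : gfam T).
Hypotheses (xP : ops x) (xT : ops x') (fB : morphB f).
Hypothesis fx : forall k u, f (x k u) = x' k (f u).
Hypotheses (sY : subgrp Y) (Yx : stable e x Y).
Hypothesis ZE : forall g u, Z g u <-> Y g u /\ f u = 0.
Hypothesis fY : forall g u, Y g u -> X g (f u).
Hypothesis fX : forall g v, X g v -> exists2 u, Y g u & f u = v.
Variables (s : seq I) (g : G).

Local Notation F := (kmap e (fun=> f)).

Let sub_ZE h i (u : kos P s) :
  kmem e Z h i u <-> kmem e Y h i u /\ F h u = 0.
Proof.
have f0 := morphB0 fB.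
elim: s h i u => [|k s' IH] h i u /=.
  rewrite ZE; split=> [[[? ?] ?]|[[? ?] ?]] //.
split.
  by move=> [/IH [? ->] /IH [? ->]].
move=> [[? ?] [? ?]]; split; exact/IH.
Qed.

Let lift h i (v : kos T s) :
  kmem e X h i v -> exists2 u, kmem e Y h i u & F h u = v.
Proof.
elim: s h i v => [|k s' IH] h i v /=.
  move=> [/fX [u Yu uE] vi]; have [i0|i0] := eqVneq i 0.
    by exists u; last exact: uE; split=> //; rewrite i0.
  exists 0; first by split=> //; case: (sY h).
  by rewrite (morphB0 fB) vi.
by case: v => v1 v2 /= [/IH [u1 ? <-] /IH [u2 ? <-]]; exists (u1, u2).
Qed.

Let Fd h (u : kos P s) : F h (kd e x u) = kd e x' (F h u).
Proof. exact: kmap_kd. Qed.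

(** The two pieces of the long exact sequence of a short exact sequence
    Z, Y, X that dimension shifting uses. *)
Lemma exact_quotient i :
  exact_at x Z s g i -> exact_at x Y s g (i + 1) -> exact_at x' X s g (i + 1).
Proof.
move=> eZ eY v /lift [u Yu <-]; rewrite -Fd => du.
have Zdu : kmem e Z g i (kd e x u).
  by apply/sub_ZE; split=> //; rewrite -[i](addrK 1); apply: kmem_kd; case: xP.
have [w /sub_ZE [Yw Fw] dw] := eZ _ Zdu (kdK e u xP).
have [||w' Yw' dw'] := eY (u - w).
- exact: kmemB.
- by rewrite (kdB _ xP.1) dw subrr.
exists (F g w'); first by apply: kmap_kmem Yw' => *; [exact: morphB0|exact: fY].
by rewrite -Fd dw' (kmapB _ _ (fun=> fB)) Fw subr0.
Qed.

Lemma exact_sub_boundary i (z y : kos P s) : exact_at x' X s g (i + 1) ->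
  kmem e Z g i z -> kmem e Y g (i + 1) y -> kd e x y = z ->
  exists2 w, kmem e Z g (i + 1) w & kd e x w = z.
Proof.
move=> eX /sub_ZE [Yz Fz] Yy dy.
have [||w /lift [u Yu <-] dw] := eX (F g y).
- by apply: kmap_kmem Yy => *; [exact: morphB0|exact: fY].
- by rewrite -Fd dy.
exists (y - kd e x u); last by rewrite (kdB _ xP.1) (kdK e u xP) subr0.
apply/sub_ZE; split; last by rewrite (kmapB _ _ (fun=> fB)) Fd dw subrr.
apply: kmemB => //; rewrite -[i + 1](addrK 1).
by apply: kmem_kd => //; case: xP.
Qed.

End ShortExact.

Section Division.
Variables (T : zmodType) (x : I -> T -> T) (X : gfam T) (D : I -> G -> T -> T).
Hypotheses (xT : ops x) (sX : subgrp X) (Xx : stable e x X).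
Hypothesis DB : forall k g, morphB (D k g).
Hypothesis Dx : forall k l g u, k != l -> D k g (x l u) = x l (D k (g - e l) u).
Hypothesis Dxx : forall k g u, X (g - e k) u -> D k g (x k u) = u.
Hypothesis XD : forall k g u, X g u -> X (g - e k) (D k g u).

(** A free module admits, for each variable, an additive division that inverts
    the multiplication and commutes with the other variables.  Dividing the
    first component of a cycle [(u, v)] moves the cycle to one of the form
    [(r, 0)], a cycle over one variable less. *)
Lemma exact_division s g i : uniq s -> i != 0 -> exact_at x X s g i.
Proof.
have [xB _] := xT.
elim: s g i => [|k s IH] g i /=.
  move=> _ i0 u [_ /(_ i0) ->] _; exists 0; last by [].
  by split=> //; case: (sX g).
move=> /andP[ks us] i0 [u v] /= [Xu Xv] [du dv].
have {}dv : kd e x v = 0 by rewrite -[LHS]opprK dv oppr0.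
have DX j (w : kos T s) : kmem e X g j w ->
    kmem e X (g - e k) j (kmap e (D k) g w).
  move=> Xw; apply: (kmem_ext (X := fun h => X (h - e k)) (g := g)).
    by move=> d t; rewrite addrAC.
  by apply: kmap_kmem Xw => [d|d t]; [exact: morphB0|exact: XD].
have xX j (w : kos T s) : kmem e X (g - e k) j w ->
    kmem e X g j (kmap e (fun=> x k) 0 w).
  move=> Xw; rewrite (@eq_kmap _ _ _ _ _ (fun=> x k) (fun=> x k) s 0 g) //.
  apply: kmap_kmem Xw => [d|d t]; first exact: (morphB0 (xB k)).
  by rewrite addrAC; exact: Xx.
pose Du := kmap e (D k) g u.
have dDu : kd e x Du = - v.
  rewrite /Du -(@kmap_kd _ _ _ _ _ x (D k) x) //; last first.
    by move=> l h t ls; rewrite Dx //; apply: contraNneq ks => ->.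
  have -> : kd e x u = - kmap e (fun=> x k) 0 v.
    by apply/eqP; rewrite -subr_eq0 opprK du.
  rewrite (morphBN (kmapB _ _ (DB k))); congr (- _).
  rewrite (@eq_kmap _ _ _ _ _ (fun=> x k) (fun=> x k) s 0 g) // kmap_comp.
  apply: (kmap_id_on (X := X)) Xv _ => d t _ Xt; apply: Dxx.
  by rewrite addrAC.
pose r := u - kmap e (fun=> x k) 0 Du.
have Xr : kmem e X g i r by apply: kmemB => //; apply: xX; exact: DX.
have dr : kd e x r = 0.
  rewrite (kdB _ xB) -(@kmap_kd _ _ _ _ _ x (fun=> x k) x); first last.
  - by move=> l h t _; case: xT => _ ->.
  - by move=> _; exact: xB.
  by rewrite dDu (morphBN (kmapB _ _ (fun=> xB k))) opprK.
have [w Xw dw] := IH g i us i0 r Xr dr.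
exists (w, Du) => /=; last by rewrite dw subrK dDu opprK.
by split=> //; rewrite addrK; exact: DX.
Qed.

Fixpoint remainder (s : seq I) (g : G) (u : T) : T :=
  if s is k :: s' then remainder s' g (u - x k (D k g u)) else u.

(** Each step of the division writes [u] as a multiple of one operator plus the
    rest, so an element without remainder is a combination of multiples. *)
Lemma kone_bound_division s g u : X g u -> remainder s g u = 0 ->
  exists2 w : kos T s, kmem e X g 1 w & kd e x w = kone s u.
Proof.
have [xB _] := xT.
elim: s u => [|k s IH] u Xu /=.
  by move=> ->; exists 0 => //; split=> //; case: (sX g).
have XDu : X (g - e k) (D k g u) by exact: XD.
move=> /IH []; first by case: (sX g) => _; apply=> //; exact: Xx.
move=> w Xw dw; exists (w, kone s (D k g u)) => /=.
  by split=> //; apply/kmem0P => //; exists (D k g u).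
rewrite kd_kone // oppr0 dw kmap_kone // -(morphBD (@koneB _ _ _)) ?subrK //.
Qed.

End Division.

Section Decomposition.
Variables (T T' : zmodType) (x : I -> T -> T) (x' : I -> T' -> T').
Variables (A : Type) (r : seq A) (X : gfam T) (X' : A -> gfam T').
Variables (pr : A -> G -> T -> T') (inj : A -> G -> T' -> T) (g : G).
Hypotheses (xT : ops x) (sX : subgrp X).
Hypothesis prB : forall a h, morphB (pr a h).
Hypothesis injB : forall a h, morphB (inj a h).
Hypothesis prx : forall a k h u, X (h - e k) u ->
  pr a h (x k u) = x' k (pr a (h - e k) u).
Hypothesis injx : forall a k h u, X' a (h - e k) u ->
  inj a h (x' k u) = x k (inj a (h - e k) u).
Hypothesis prX : forall a h u, X h u -> X' a h (pr a h u).
Hypothesis injX : forall a h u, X' a h u -> X h (inj a h u).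
Hypothesis prK : forall d u, shift e d -> X (g - d) u ->
  u = \sum_(a <- r) inj a (g - d) (pr a (g - d) u).

(** A module that is a finite direct sum, by maps that may depend on the
    degree, is acyclic as soon as its summands are.  A one-element index gives
    the case of a retract.  The maps are only asked to commute with the
    operators on members of the families: an embedding of a coefficient as a
    monomial does not commute with a variable across degree 0. *)
Lemma exact_decomposition s i :
  (forall a, exact_at x' (X' a) s g i) -> exact_at x X s g i.
Proof.
move=> eX' u Xu du.
have /choice [w Xw] : forall a, exists w : kos T' s,
    kmem e (X' a) g (i + 1) w /\ kd e x' w = kmap e (pr a) g u.
  move=> a; have [||w ? ?] := eX' a (kmap e (pr a) g u); last by exists w.
  - by apply: kmap_kmem Xu => [d|d v]; [exact: morphB0|exact: prX].
  - by rewrite -(kmap_kd_on _ Xu (@prx a)) // du (morphB0 (kmapB _ _ _)).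
exists (\sum_(a <- r) kmap e (inj a) g (w a)).
  apply: kmem_sum => // a; apply: kmap_kmem (Xw a).1 => [d|d v].
    exact: morphB0.
  exact: injX.
have dB := @kdB _ _ e _ _ s xT.1.
rewrite (morphB_sum dB) -[RHS](@kmap_id_on _ _ e _
  (fun h v => \sum_(a <- r) inj a h (pr a h v)) _ s _ g _ _ Xu); last first.
  by move=> d v sd Xv; rewrite -prK.
rewrite kmap_sumf; apply: eq_bigr => a _.
by rewrite -(kmap_kd_on _ (Xw a).1 (@injx a)) // (Xw a).2 kmap_comp.
Qed.

End Decomposition.

Section Cone.
Variables (T : zmodType) (x : I -> T -> T) (X : gfam T) (k : I) (s : seq I).
Hypotheses (xT : ops x) (sX : subgrp X) (Xx : stable e x X).
Variables (g : G) (i : int).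

Let xk : kos T s -> kos T s := kmap e (fun=> x k) 0.

Let xkB : morphB xk. Proof. by apply: kmapB => _; case: xT. Qed.

Let kmem_xk j (w : kos T s) : kmem e X (g - e k) j w -> kmem e X g j (xk w).
Proof.
move=> Xw; rewrite /xk.
rewrite (@eq_kmap _ _ _ _ _ (fun=> x k) (fun=> x k) s 0 g) //.
apply: kmap_kmem Xw => [d|d v]; first by apply: morphB0; case: xT.
by rewrite addrAC; exact: Xx.
Qed.

Let xkd (w : kos T s) : xk (kd e x w) = kd e x (xk w).
Proof.
apply: kmap_kd => [_|l _ v _]; first by case: xT.
by case: xT => _ ->.
Qed.

(** The two remaining pieces of the long exact sequence of a cone. *)
Lemma exact_cone : exact_at x X s g i -> exact_at x X s (g - e k) (i - 1) ->
  exact_at x X (k :: s) g i.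
Proof.
have dB := @kdB _ _ e _ _ s xT.1.
move=> e1 e2 [u v] /= [Xu Xv] [du dv].
have [|w Xw dw] := e2 v Xv; first by rewrite -[LHS]opprK dv oppr0.
rewrite subrK in Xw.
have [||w' Xw' dw'] := e1 (u + xk w).
- by apply: kmemD => //; exact: kmem_xk.
- by rewrite (morphBD dB) -xkd dw.
exists (w', - w) => /=.
  by split=> //; rewrite addrK; exact: kmemN.
by rewrite -/xk (morphBN xkB) (morphBN dB) opprK dw' dw addrK.
Qed.

Lemma exact_cone_base : exact_at x X s (g - e k) i ->
  exact_at x X (k :: s) g i -> exact_at x X s g i.
Proof.
have dB := @kdB _ _ e _ _ s xT.1.
move=> e1 e2 u Xu du.
have [||[w1 w2] /= [Xw1 Xw2] [dw1 dw2]] := e2 (u, 0).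
- by split=> //=; exact: kmem0.
- by rewrite /= -/xk (morphB0 xkB) (morphB0 dB) du addr0 oppr0.
rewrite addrK in Xw2.
have [|w3 Xw3 dw3] := e1 w2 Xw2; first by rewrite -[LHS]opprK dw2 oppr0.
exists (w1 + xk w3); first by apply: kmemD => //; exact: kmem_xk.
by rewrite (morphBD dB) -xkd dw3.
Qed.

End Cone.

Section Reorder.
Variables (T : zmodType) (x : I -> T -> T).
Hypothesis xT : ops x.

(** Isomorphisms between the Koszul complexes of two orderings of the
    operators; commutation with the operators lets them pass through cones. *)
Definition khom (s s' : seq I) (phi : kos T s -> kos T s') : Prop :=
  [/\ morphB phi, forall u, kd e x (phi u) = phi (kd e x u),
      forall k u, kmap e (fun=> x k) 0 (phi u) =
                  phi (kmap e (fun=> x k) 0 u) &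
      forall X g i u, subgrp X -> kmem e X g i u -> kmem e X g i (phi u)].

Lemma exact_transfer s s' phi psi X g i : @khom s s' phi -> @khom s' s psi ->
  cancel psi phi -> subgrp X -> exact_at x X s g i -> exact_at x X s' g i.
Proof.
move=> [pB pd _ pX] [qB qd _ qX] pq sX eX u Xu du.
have [||w Xw dw] := eX (psi u); first exact: qX.
  by rewrite qd du (morphB0 qB).
by exists (phi w); [exact: pX|rewrite pd dw pq].
Qed.

Lemma khom_id s : khom (@id (kos T s)). Proof. by split. Qed.

Lemma khom_comp s1 s2 s3 phi psi : @khom s1 s2 phi -> @khom s2 s3 psi ->
  khom (fun u => psi (phi u)).
Proof.
move=> [pB pd px pX] [qB qd qx qX]; split=> *.
- by move=> u v /=; rewrite pB qB.
- by rewrite qd pd.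
- by rewrite qx px.
- by apply: qX => //; exact: pX.
Qed.

Lemma khom_cons k s s' phi : @khom s s' phi ->
  @khom (k :: s) (k :: s') (fun u => (phi u.1, phi u.2)).
Proof.
move=> [pB pd px pX]; split=> /=.
- by move=> u v /=; rewrite !pB.
- by move=> u; rewrite px !pd (morphBD pB) (morphBN pB).
- move=> l [u1 u2] /=; rewrite px; congr pair.
  by rewrite !(@eq_kmap _ _ _ _ _ (fun=> x l) (fun=> x l) _ (0 - e k) 0) // px.
- by move=> X g i u sX [? ?]; split; exact: pX.
Qed.

Lemma khom_swap k l s :
  @khom (k :: l :: s) (l :: k :: s)
    (fun u => ((u.1.1, u.2.1), (u.1.2, - u.2.2))).
Proof.
have [xB _] := xT; have dB := @kdB _ _ e _ _ s xB.
have mB j h : morphB (@kmap _ _ e _ _ (fun=> x j) s h).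
  by apply: kmapB => _.
have mE j h : @kmap _ _ e _ _ (fun=> x j) s h =1 kmap e (fun=> x j) 0.
  by move=> u; exact: eq_kmap.
split=> /=.
- move=> [[a b] [c d]] [[a' b'] [c' d']] /=; congr (_, _).
  by congr pair; rewrite /= opprD.
- move=> [[a b] [c d]] /=; rewrite !mE !(morphBN (mB _ _)) !(morphBN dB) !opprK.
  congr ((_, _), (_, _)) => /=.
  + by rewrite addrAC.
  + by rewrite opprD.
  + by rewrite opprB addrC.
- move=> j [[a b] [c d]] /=.
  by rewrite !mE (morphBN (mB _ _)).
- move=> X g i [[a b] [c d]] sX /= [[? ?] [? Xd]]; split=> //; split=> //.
  by apply: kmemN => //; rewrite addrAC.
Qed.

Lemma khom_front k s : k \in s -> exists phi psi,
  [/\ @khom s (k :: rem k s) phi, @khom (k :: rem k s) s psi,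
      cancel phi psi & cancel psi phi].
Proof.
elim: s => [//|l s IH]; rewrite inE /=.
have [-> _|kl /= /IH [phi [psi [hp hq pq qp]]]] := eqVneq k l.
  by exists id, id; split=> //; exact: khom_id.
exists (fun u : kos T (l :: s) => let v := (phi u.1, phi u.2) in
    ((v.1.1, v.2.1), (v.1.2, - v.2.2))).
exists (fun u : kos T (k :: l :: rem k s) =>
  let v : kos T (l :: k :: rem k s) :=
    ((u.1.1, u.2.1), (u.1.2, - u.2.2)) in (psi v.1, psi v.2)).
split.
- exact: (khom_comp (khom_cons l hp) (khom_swap l k (rem k s))).
- exact: (khom_comp (khom_swap k l (rem k s)) (khom_cons l hq)).
- by move=> [a b] /=; rewrite opprK -!surjective_pairing !pq.
- move=> [[a b] [c d]] /=; rewrite !qp /= opprK //.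
Qed.

(** Lets an argument on one variable take its cone as the outermost one. *)
Lemma exact_front k s X g i : k \in s -> subgrp X ->
  exact_at x X (k :: rem k s) g i <-> exact_at x X s g i.
Proof.
move=> /khom_front [phi [psi [hp hq pq qp]]] sX.
by split; [exact: (exact_transfer hq hp)|exact: (exact_transfer hp hq)].
Qed.

End Reorder.

End KoszulExactness.

(** * Increasing families of subspaces *)

Notation zdeg n := {ffun 'I_n -> int}.

Definition unitdeg n (k : 'I_n) : zdeg n := [ffun i => (i == k)%:Z].

(** A torsion-free multigraded module is an increasing family of subspaces of
    one space, on which the variables act by the identity. *)
Definition idops (I T : Type) : I -> T -> T := fun=> id.

Section Filtered.
Variable n : nat.
Local Notation G := (zdeg n).
Local Notation e := (@unitdeg n).
Local Notation exact_at x := (exact_at e x).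
Local Notation idops := (@idops 'I_n _).

Lemma unitdegE (g : G) k l : (g - e k) l = g l - (l == k)%:Z.
Proof. by rewrite !ffunE. Qed.

Lemma sub_unitdeg_id (g : G) k : (g - e k) k = g k - 1.
Proof. by rewrite unitdegE eqxx. Qed.

Lemma sub_unitdeg_ne (g : G) k l : l != k -> (g - e k) l = g l.
Proof. by rewrite unitdegE => /negPf ->; rewrite subr0. Qed.

Lemma sub_unitdeg_le (g : G) k l : (g - e k) l <= g l.
Proof. by rewrite unitdegE gerBl; case: (l == k). Qed.

Lemma ops_id (T : zmodType) : ops (idops : 'I_n -> T -> T).
Proof. by split. Qed.

Lemma kmap_id (T : zmodType) s (g : G) (u : kos T s) :
  kmap e (fun=> id) g u = u.
Proof. by elim: s g u => [|k s IH] g u //=; rewrite !IH; case: u. Qed.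

Section Family.
Variable T : zmodType.
Implicit Types (X Y : gfam G T) (s : seq 'I_n) (g b : G) (i : int).

(** Only the degrees [h] below [g] that agree with [g] off [s] occur in a chain
    of degree [g]. *)
Lemma kmem_local X Y s g i (u : kos T s) :
  (forall (h : G) v, (forall l, h l <= g l) ->
     (forall l, l \notin s -> h l = g l) -> X h v -> Y h v) ->
  kmem e X g i u -> kmem e Y g i u.
Proof.
elim: s g i u => [|k s IH] g i u XY /=.
  by move=> [Xu ui]; split=> //; exact: XY Xu.
move=> [u1 u2]; split.
  apply: IH u1 => h v hg hs; apply: XY => // l.
  by rewrite inE negb_or => /andP[_]; exact: hs.
apply: IH u2 => h v hg hs; apply: XY => l.
  exact: le_trans (hg l) (sub_unitdeg_le _ _ _).
rewrite inE negb_or => /andP[lk ls].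
by rewrite hs // sub_unitdeg_ne.
Qed.

Lemma exact_local x X Y s g i :
  (forall (h : G) v, (forall l, h l <= g l) ->
     (forall l, l \notin s -> h l = g l) ->
     (X h v <-> Y h v)) ->
  exact_at x X s g i -> exact_at x Y s g i.
Proof.
move=> XY eX u Yu du; have [|w Xw dw] := eX u _ du.
  by apply: kmem_local Yu => h v hg hs /(XY _ _ hg hs).
by exists w => //; apply: kmem_local Xw => h v hg hs /(XY _ _ hg hs).
Qed.

Lemma kmem_zero X s g i (u : kos T s) :
  (forall (h : G) v, (forall l, h l <= g l) ->
     (forall l, l \notin s -> h l = g l) -> X h v -> v = 0) ->
  kmem e X g i u -> u = 0.
Proof.
move=> X0 /(kmem_local (Y := fun _ v => v = 0) X0) {X0}.
elim: s g i u => [|k s IH] g i u /=; first by case.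
by case: u => u v /= [/IH -> /IH ->].
Qed.

Lemma exact_zero x X s g i : subgrp X ->
  (forall (h : G) v, (forall l, h l <= g l) ->
     (forall l, l \notin s -> h l = g l) -> X h v -> v = 0) ->
  (forall k, morphB (x k)) -> exact_at x X s g i.
Proof.
move=> sX X0 xB u /(kmem_zero X0) -> _.
by exists 0; [exact: kmem0|exact: morphB0 (kdB _ xB)].
Qed.

Section Increasing.
Variable X : gfam G T.
Hypotheses (sX : subgrp X) (Xx : stable e idops X).

(** Where multiplication by the variable [k] is an isomorphism, the two copies
    glued by the cone over [k] cancel. *)
Lemma exact_cone_iso k s g i : uniq s -> k \in s ->
  (forall (h : G) v, h k = g k -> X h v -> X (h - e k) v) ->
  exact_at idops X s g i.
Proof.
elim: s g i => [//|l s IH] g i /= /andP[ls us]; rewrite inE.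
have [kl _ Xk|lk /= ks Xk] := eqVneq k l; last first.
  apply: exact_cone => //.
    exact: IH.
  apply: IH => // h v; rewrite sub_unitdeg_ne //; exact: Xk.
subst l => {IH}; move=> [u v] /= [Xu Xv]; rewrite kmap_id => -[du dv].
exists (0, u) => /=.
  split; first exact: kmem0.
  rewrite addrK; apply: (kmem_ext (X := fun h => X (h - e k)) (g := g)).
    by move=> d t; rewrite addrAC.
  by apply: kmem_local Xu => h w _ hs; apply: Xk; exact: hs.
rewrite kmap_id (morphB0 (kdB _ (ops_id T).1)) add0r.
by congr pair; apply/eqP; rewrite -subr_eq0 -opprD oppr_eq0 du.
Qed.

Hypothesis X_neg : forall g v, X g v -> (exists k, g k < 0) -> v = 0.

(** For the family of an ideal and [r] the list of all variables, this is the
    intersection with the principal ideal of the monomial of degree [d]. *)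
Definition trunc (d : 'I_n -> int) (r : seq 'I_n) : gfam G T :=
  fun g v => X g v /\ (forall l, l \in r -> g l < d l -> v = 0).

Lemma trunc_subgrp d r : subgrp (trunc d r).
Proof.
move=> g; have [X0 XB] := sX g; split=> [|u v [Xu u0] [Xv v0]]; first by split.
split=> [|l lr gl]; first exact: XB.
by rewrite (u0 l) // (v0 l) // subrr.
Qed.

Lemma trunc_stable d r : stable e idops (trunc d r).
Proof.
move=> g k u [Xu u0]; split=> [|l lr gl]; first exact: Xx.
apply: (u0 l) => //; exact: le_lt_trans (sub_unitdeg_le _ _ _) gl.
Qed.
End Increasing.

(** Truncation in one variable: a nonzero class of the truncated family in
    degree [b] comes from the jump at [d], hence from a class of the family in
    some degree [c] with the [k]-th entry at most [d]. *)
Lemma exact_trunc1 X (d : 'I_n -> int) k s b i :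
  subgrp X -> stable e idops X ->
  (forall g v, X g v -> (exists k, g k < 0) -> v = 0) ->
  uniq s -> k \in s ->
  (forall c : G, (forall l, l != k -> c l = b l) -> Num.max (c k) (d k) = b k ->
     exact_at idops X s c i) ->
  exact_at idops (trunc X d [:: k]) s b i.
Proof.
move=> sX Xx X_neg us ks eX.
have sX' := trunc_subgrp sX d [:: k]; 
  have Xx' : stable e idops (trunc X d [:: k]) by exact: trunc_stable.
apply/(exact_front e (ops_id T) _ _ ks sX').
have {}eX (c : G) : (forall l, l != k -> c l = b l) ->
    Num.max (c k) (d k) = b k -> exact_at idops X (k :: rem k s) c i.
  by move=> cb cd; apply/(exact_front e (ops_id T) _ _ ks sX); exact: eX.
have kr : k \notin rem k s by rewrite mem_rem_uniqF.
have zero (c : G) j s' : c k < d k -> exact_at idops (trunc X d [:: k]) s' c j.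
  move=> cd; apply: exact_zero => // h v hc _ [_ /(_ k (mem_head _ _))]; apply.
  exact: le_lt_trans (hc k) cd.
have [bd|bd|bd] := ltgtP (b k) (d k); first exact: zero.
  have memE j u : kmem e (trunc X d [:: k]) (s := k :: rem k s) b j u <->
                  kmem e X (s := k :: rem k s) b j u.
    split; first by apply: kmem_local => h v _ _ [].
    move=> [Xu1 Xu2]; split; [apply: kmem_local Xu1|apply: kmem_local Xu2];
      move=> h v _ /(_ _ kr) hk Xv; split=> // l; rewrite inE => /eqP ->;
      rewrite hk ?sub_unitdeg_id; lia.
  move=> u /memE Xu du; have [|//|w /memE Xw dw] := eX b _ _ u Xu du => //.
    by apply/max_idPl; exact: ltW.
  by exists w.
apply: exact_cone => //; last first.
  by apply: zero; rewrite sub_unitdeg_id bd ltrBlDr ltrDl.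
apply: (exact_local (X := X)) => [h v _ hs|].
  split=> [Xv|[]//]; split=> // l; rewrite inE => /eqP ->.
  by rewrite hs // bd ltxx.
suff H m (c : G) : (forall l, l != k -> c l = b l) -> c k <= d k ->
    c k < m%:Z -> exact_at idops X (rem k s) c i.
  apply: (H `|b k|.+1) => //; first by rewrite bd.
  lia.
elim: m c => [|m IH] c cb cd cm.
  apply: exact_zero => // h v hc _ /X_neg; apply; exists k.
  exact: le_lt_trans (hc k) cm.
apply: exact_cone_base => //; last first.
  by apply: eX => //; rewrite bd; apply/max_idPr.
apply: IH => [l lk||]; first by rewrite sub_unitdeg_ne // cb.
  exact: le_trans (sub_unitdeg_le _ _ _) cd.
by rewrite sub_unitdeg_id; lia.
Qed.

(** The variables of [r] are truncated one after the other; what accumulates is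
    the join with [d]. *)
Lemma exact_trunc X (d : 'I_n -> int) r s b i :
  subgrp X -> stable e idops X ->
  (forall g v, X g v -> (exists k, g k < 0) -> v = 0) ->
  uniq s -> uniq r -> {subset r <= s} ->
  (forall c : G, (forall l, l \notin r -> c l = b l) ->
     (forall l, l \in r -> Num.max (c l) (d l) = b l) ->
     exact_at idops X s c i) ->
  exact_at idops (trunc X d r) s b i.
Proof.
move=> sX Xx X_neg us; elim: r b => [|k r IH] b /= ur rs eX.
  apply: (exact_local (X := X)); last exact: eX.
  by move=> h v _ _; split=> [Xv|[]].
move: ur => /andP[kr ur].
apply: (exact_local (X := trunc (trunc X d r) d [:: k])).
  move=> h v _ _; split=> [[[Xv vr] vk]|[Xv vr]].
    split=> // l; rewrite inE => /orP[/eqP ->|]; last exact: vr.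
    by apply: vk; rewrite mem_head.
  split=> [|l]; last by rewrite inE => /eqP ->; apply: vr; rewrite mem_head.
  by split=> // l lr; apply: vr; rewrite inE lr orbT.
apply: exact_trunc1 => //.
- exact: trunc_subgrp.
- exact: trunc_stable.
- by move=> g v [/X_neg].
- by apply: rs; rewrite mem_head.
move=> c cb ck; apply: IH => // [l lr|c' cr' cd'].
  by apply: rs; rewrite inE lr orbT.
apply: eX => l.
  rewrite inE negb_or => /andP[lk lr]; by rewrite cr' // cb.
rewrite inE => /orP[/eqP ->|lr]; first by rewrite cr'.
by rewrite cd' // cb //; apply: contraNneq kr => <-.
Qed.

End Family.
End Filtered.

(** * Restriction of a family to the degrees of an ideal *)

(** A subspace of largest dimension inside [Q] is all of [Q]. *)
Lemma vspace_of_pred (K : fieldType) (T : vectType K) (Q : T -> Prop) :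
  Q 0 -> (forall c u v, Q u -> Q v -> Q (c *: u + v)) ->
  exists V : {vspace T}, forall u, u \in V <-> Q u.
Proof.
move=> Q0 QL.
pose ok (m : nat) := `[< exists V : {vspace T},
  (\dim V = m) /\ forall u, u \in V -> Q u >].
have ex0 : exists m, ok m.
  exists 0%N; apply/asboolP; exists 0%VS; rewrite dimv0; split=> // u.
  by rewrite memv0 => /eqP ->.
have okb m : ok m -> (m <= \dim {:T})%N.
  by move=> /asboolP[V [<- _]]; exact: dimvS (subvf V).
case: (ex_maxnP ex0 okb) => m /asboolP[V [dV VQ]] mmax.
exists V => u; split=> [/VQ//|Qu].
have VuQ w : w \in (V + <[u]>)%VS -> Q w.
  move=> /memv_addP[v Vv [_ /vlineP[c ->] ->]].
  by rewrite addrC; apply: QL => //; exact: VQ.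
have := mmax (\dim (V + <[u]>)); rewrite -dV => H.
have {}H : (\dim (V + <[u]>) <= \dim V)%N.
  by apply: H; apply/asboolP; exists (V + <[u]>)%VS.
have /eqP VE : V == (V + <[u]>)%VS by rewrite eqEdim addvSl.
by rewrite VE; apply: (subvP (addvSr V _)); exact: memv_line.
Qed.

Section Product.
Variables (K : fieldType) (n : nat).
Local Notation G := (zdeg n).
Local Notation e := (@unitdeg n).
Local Notation s := (enum 'I_n).
Local Notation exact_id X := (exact_at e (@idops 'I_n _) X s).

Definition vfam (T : vectType K) (B : G -> {vspace T}) : gfam G T :=
  fun g u => u \in B g.

(** A monomial ideal as a family: the line [K] in the degrees of its monomials,
    zero elsewhere. *)
Definition degfam (J : pred G) : gfam G K^o := fun g c => ~~ J g -> c = 0.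

Definition restr (T : zmodType) (J : pred G) (X : gfam G T) : gfam G T :=
  fun g u => X g u /\ (~~ J g -> u = 0).

Lemma exact_neg (T : zmodType) x (X : gfam G T) r g (i : int) :
  subgrp X -> (forall k, morphB (x k)) -> i < 0 -> exact_at e x X r g i.
Proof.
move=> sX xB i0 u /kmem_neg -> // _.
by exists 0; [exact: kmem0|exact: morphB0 (kdB _ xB)].
Qed.

Lemma vfam_subgrp T (B : G -> {vspace T}) : subgrp (vfam B).
Proof. by move=> g; split=> [|u v]; [exact: mem0v|exact: memvB]. Qed.

Lemma restr_subgrp (T : zmodType) J (X : gfam G T) : subgrp X ->
  subgrp (restr J X).
Proof.
move=> sX g; have [X0 XB] := sX g; split=> [//|u v [Xu u0] [Xv v0]].
split=> [|Jg]; first exact: XB.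
by rewrite u0 // v0 // subrr.
Qed.

Lemma degfam_subgrp J : subgrp (degfam J).
Proof. by move=> g; split=> // u v u0 v0 Jg; rewrite u0 // v0 // subrr. Qed.

Lemma restr_stable (T : zmodType) (J : pred G) (X : gfam G T) :
  (forall g k, J (g - e k) -> J g) ->
  stable e (@idops 'I_n T) X -> stable e (@idops 'I_n T) (restr J X).
Proof.
move=> JS XS g k u [Xu u0]; split; first exact: XS Xu.
by move=> Jg; apply: u0; apply: contra Jg; exact: JS.
Qed.

Lemma degfam_stable (J : pred G) : (forall g k, J (g - e k) -> J g) ->
  stable e (@idops 'I_n _) (degfam J).
Proof.
move=> JS g k u u0 Jg; apply: u0; apply: contra Jg; exact: JS.
Qed.

Section Monotone.
Variables (T : vectType K) (B : G -> {vspace T}).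
Hypothesis BS : forall g k, (B (g - e k) <= B g)%VS.

Lemma vfam_mono (g h : G) : (forall l, g l <= h l) -> (B g <= B h)%VS.
Proof.
have [m] := ubnP (\sum_l `|h l - g l|)%N; elim: m h => // m IH h lem gh.
have [->//|/eqP ne] := eqVneq g h.
have [k gk] : exists k, g k < h k.
  apply: contrapT => nk; apply: ne; apply/ffunP => k; apply/eqP.
  rewrite eq_le gh leNgt; apply/negP => ?; apply: nk; by exists k.
apply: subv_trans (BS h k); apply: IH => [|l]; last first.
  have [->|lk] := eqVneq l k; first by rewrite sub_unitdeg_id; lia.
  by rewrite sub_unitdeg_ne.
move: lem; rewrite (bigD1 k) //= (bigD1 (P := xpredT) k) //= sub_unitdeg_id.
set S := (\sum_(l | _) _)%N; set S' := (\sum_(l | _) _)%N => lem.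
suff <- : S = S' by lia.
by apply: eq_bigr => l lk; rewrite sub_unitdeg_ne.
Qed.
End Monotone.

Section Cover.
Variables (T : vectType K) (B : G -> {vspace T}) (N : nat).
Hypothesis BS : forall g k, (B (g - e k) <= B g)%VS.
Hypothesis B_neg : forall (g : G) k, g k < 0 -> B g = 0%VS.
Hypothesis B_cap : forall g : G, B g = B [ffun l => Num.min (g l) N%:Z].

Local Notation D := {ffun 'I_n -> 'I_N.+1}.
(** The hypothesis [B_cap] says that nothing new is generated outside the box
    with side [N]; this keeps the minimal cover finite-dimensional. *)
Definition boxdeg (d : D) : G := [ffun l => (d l : nat)%:Z].
(** What the variables generate in degree [g], and a complement of it.  The
    basis vectors of the complements are the generators of the cover. *)
Definition decomposable (g : G) : {vspace T} :=
  (\sum_(k : 'I_n) B (g - e k))%VS.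
Definition newgens (d : D) : {vspace T} :=
  (B (boxdeg d) :\: decomposable (boxdeg d))%VS.
Local Notation R := (\dim {:T}).
Local Notation A := (D * 'I_R)%type.
Definition gen (a : A) : T := (vbasis (newgens a.1))`_a.2.
Definition valid (a : A) : bool := (a.2 < \dim (newgens a.1))%N.
Local Notation F := {ffun A -> K^o}.

(** The free module on the generators, one coordinate per generator; indices
    beyond the dimension of the complement are not valid and carry 0. *)
Definition cover : gfam G F :=
  fun g u => forall a, u a != 0 -> valid a /\ forall l, boxdeg a.1 l <= g l.

Definition cover_map (u : F) : T := \sum_a (u a : K) *: gen a.

Lemma cover_linear c u v :
  cover_map (c *: u + v) = c *: cover_map u + cover_map v.
Proof.
rewrite scaler_sumr -big_split; apply: eq_bigr => a _ /=.
by rewrite !ffunE scalerDl scalerA.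
Qed.

Lemma cover_map0 : cover_map 0 = 0.
Proof. by apply: big1 => a _; rewrite ffunE scale0r. Qed.

Lemma cover_mapB : morphB cover_map.
Proof.
move=> u v; rewrite addrC -scaleN1r cover_linear scaleN1r addrC //.
Qed.

Lemma cover_map_sum (C : Type) (r : seq C) (f : C -> F) :
  cover_map (\sum_(i <- r) f i) = \sum_(i <- r) cover_map (f i).
Proof. exact: (morphB_sum cover_mapB). Qed.

Lemma cover_subspace g c u v : cover g u -> cover g v -> cover g (c *: u + v).
Proof.
move=> Pu Pv a; rewrite !ffunE => nz.
have [ua|/Pu//] := eqVneq (u a) 0; apply: Pv.
by move: nz; rewrite ua scaler0 add0r.
Qed.

Lemma cover0 g : cover g 0. Proof. by move=> a; rewrite ffunE eqxx. Qed.

Lemma cover_subgrp : subgrp cover.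
Proof.
move=> g; split=> [|u v Pu Pv]; first exact: cover0.
by rewrite addrC -scaleN1r; exact: cover_subspace.
Qed.

Lemma cover_mono (g h : G) u : (forall l, g l <= h l) -> cover g u -> cover h u.
Proof.
move=> gh Pu a /Pu[va ag]; split=> // l; exact: le_trans (gh l).
Qed.

Lemma cover_stable : stable e (@idops 'I_n _) cover.
Proof.
by move=> g k u; apply: cover_mono => l; exact: sub_unitdeg_le.
Qed.

Lemma cover_neg (g : G) u k : g k < 0 -> cover g u -> u = 0.
Proof.
move=> gk Pu; apply/ffunP => a; rewrite ffunE; apply/eqP.
apply: contraT => /Pu[_ /(_ k)]; rewrite ffunE => h.
by have := le_lt_trans h gk; lia.
Qed.

Lemma cover_cap (g : G) u :
  cover g u <-> cover [ffun l => Num.min (g l) N%:Z] u.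
Proof.
split; last by apply: cover_mono => l; rewrite ffunE ge_min lexx.
move=> Pu a /Pu[va ag]; split=> // l; rewrite !ffunE le_min.
have := ag l; rewrite ffunE => -> /=; rewrite lez_nat -ltnS; exact: ltn_ord.
Qed.

Lemma cover_map_in g u : cover g u -> vfam B g (cover_map u).
Proof.
move=> Pu; rewrite /vfam; apply: memv_suml => a _.
have [->|/Pu[va ag]] := eqVneq (u a) 0; first by rewrite scale0r mem0v.
apply: memvZ; apply: (subvP (vfam_mono BS ag)).
apply: (subvP (diffvSl _ (decomposable (boxdeg a.1)))); apply: vbasis_mem.
by apply: mem_nth; rewrite size_tuple.
Qed.

(** The coordinates are extended by 0 from the dimension of the complement to
    that of [T], the common bound for the second index. *)
Lemma newgens_expand (d : D) w : w \in newgens d ->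
  exists2 u : F, cover (boxdeg d) u & cover_map u = w.
Proof.
move=> wU; pose X := vbasis (newgens d).
pose c (r : nat) : K := oapp (fun r' => coord X r' w) 0 (insub r).
exists [ffun a : A => if (a.1 == d) && valid a then c a.2 else 0 : K^o].
  move=> [d' r]; rewrite ffunE /=.
  by case: ifP => [/andP[/eqP -> ?] _|]; [split|rewrite eqxx].
transitivity (\sum_(r < \dim (newgens d)) c r *: X`_r); last first.
  rewrite [RHS](coord_vbasis wU); apply: eq_bigr => r _; congr (_ *: _).
  by rewrite /c valK.
rewrite /cover_map.
rewrite (eq_bigr (fun a : A => if a.1 == d then
    (if valid a then c a.2 else 0) *: gen a else 0)); last first.
  by move=> a _; rewrite ffunE; case: eqP => //=; rewrite scale0r.
rewrite -(pair_bigA _ (fun d' r => if d' == d then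
    (if valid (d', r) then c r else 0) *: gen (d', r) else 0)) /=.
rewrite (bigD1 d) //= [X in _ + X]big1 ?addr0; last first.
  by move=> d' /negPf d'd; apply: big1 => r _; rewrite d'd.
have dimR : (\dim (newgens d) <= R)%N by exact: dimvS (subvf _).
rewrite (big_ord_widen R (fun r => c r *: X`_r) dimR) [RHS]big_mkcond eqxx /=.
apply: eq_bigr => r _; rewrite /valid /gen /=.
by case: ifP => // _; rewrite scale0r.
Qed.

(** An element splits into new generators and parts from smaller degrees;
    induction on the total degree. *)
Lemma cover_map_onto (g : G) w : vfam B g w ->
  exists2 u : F, cover g u & cover_map u = w.
Proof.
rewrite /vfam; have [[k gk]|g0] := pselect (exists k, g k < 0).
  rewrite (B_neg gk) memv0 => /eqP ->.
  by exists 0; [exact: cover0|exact: cover_map0].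
have {}g0 k : 0 <= g k by rewrite leNgt; apply/negP => ?; apply: g0; exists k.
have [m] := ubnP (\sum_l `|g l|)%N; elim: m g g0 w => // m IH g g0 w lem.
pose d : D := [ffun l => inord (minn `|g l| N)].
have dE : boxdeg d = [ffun l => Num.min (g l) N%:Z].
  apply/ffunP => l; rewrite !ffunE inordK ?ltnS ?geq_minr //.
  by have := g0 l; lia.
have dg l : boxdeg d l <= g l by rewrite dE ffunE ge_min lexx.
rewrite B_cap -dE -(addv_diff_cap (B (boxdeg d)) (decomposable (boxdeg d))).
move=> /memv_addP[w1 /newgens_expand[u1 Pu1 <-] [w2 + ->]].
rewrite memv_cap => /andP[_ /memv_sumP[y Yy ->]].
have /choice [v Pv] : forall k, exists v, cover g v /\ cover_map v = y k.
  move=> k; have [dk|dk] := ltP ((boxdeg d - e k) k) 0.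
    have := Yy k isT; rewrite (B_neg dk) memv0 => /eqP ->.
    by exists 0; split; [exact: cover0|exact: cover_map0].
  have [l||v Pv <-] := IH (boxdeg d - e k) _ (y k) _ (Yy k isT).
  - have [->//|lk] := eqVneq l k.
    by rewrite sub_unitdeg_ne // ffunE.
  - apply: leq_trans _ (lem : _ <= m)%N.
    rewrite (bigD1 k) //= [X in (_ < X)%N](bigD1 k) //= -addSn.
    apply: leq_add.
      move: dk; rewrite sub_unitdeg_id; have := dg k; have := g0 k; lia.
    apply: leq_sum => l lk; rewrite sub_unitdeg_ne //.
    by have := dg l; rewrite ffunE; have := g0 l; lia.
  exists v; split=> //; apply: cover_mono Pv => l.
  exact: le_trans (sub_unitdeg_le _ _ _) (dg l).
exists (u1 + \sum_k v k).
  apply: (subgrpD cover_subgrp); first exact: cover_mono Pu1.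
  by apply: subgrp_sum => [|k]; [exact: cover_subgrp|case: (Pv k)].
rewrite (morphBD cover_mapB) cover_map_sum; congr (_ + _).
by apply: eq_bigr => k _; case: (Pv k).
Qed.

(** Dividing by the variable [k] drops the generators that do not yet exist in
    degree [g - e k]. *)
Definition cover_div (k : 'I_n) (g : G) (u : F) : F :=
  [ffun a => if boxdeg a.1 k < g k then u a else 0].

Let idT (X : zmodType) := ops_id n X.

Let cover_divB k g : morphB (cover_div k g).
Proof.
move=> u v; apply/ffunP => a; rewrite !ffunE; case: ifP => //.
by rewrite subr0.
Qed.

Let cover_div_in k g u : cover g u -> cover (g - e k) (cover_div k g u).
Proof.
move=> Pu a; rewrite ffunE; case: ifP => [ak /Pu[va ag]|]; last by rewrite eqxx.
split=> // l; have [->|lk] := eqVneq l k; last by rewrite sub_unitdeg_ne.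
by rewrite sub_unitdeg_id; lia.
Qed.

Let cover_div_id k g u : cover (g - e k) u -> cover_div k g u = u.
Proof.
move=> Pu; apply/ffunP => a; rewrite ffunE; case: ifPn => // ak.
apply/esym/eqP; apply: contraNT ak => /Pu[_ /(_ k)].
by rewrite sub_unitdeg_id; lia.
Qed.

Let cover_div_local k l g u : k != l ->
  cover_div k g u = cover_div k (g - e l) u.
Proof. by move=> kl; apply/ffunP => a; rewrite !ffunE (negPf kl) subr0. Qed.

Lemma cover_exact g (j : int) : j != 0 -> exact_id cover g j.
Proof.
move=> j0; apply: (@exact_division _ _ e F (@idops 'I_n F) cover cover_div);
  by [exact: idT|exact: cover_subgrp|exact: cover_stable|exact: cover_divB
     |exact: cover_div_local|exact: cover_div_id|exact: cover_div_in
     |exact: enum_uniq|].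
Qed.

(** In degree [g] the remainder keeps the generators of degree exactly [g]. *)
Lemma cover_boundary g u : cover g u ->
  (forall a, boxdeg a.1 = g -> u a = 0) ->
  exists2 w : kos F s, kmem e cover g 1 w & kd e (@idops 'I_n F) w = kone s u.
Proof.
move=> Pu u0.
apply: (@kone_bound_division _ _ e F (@idops 'I_n F) cover cover_div);
  try by [exact: idT|exact: cover_subgrp|exact: cover_stable|exact: cover_divB
     |exact: cover_div_local|exact: cover_div_id|exact: cover_div_in|].
have rem r v a : @remainder _ _ F (@idops 'I_n F) cover_div r g v a =
    if has (fun k => boxdeg a.1 k < g k) r then 0 else v a.
  elim: r v => [//|k r IH] v /=; rewrite IH !ffunE.
  by case: ltP => _ /=; rewrite ?subrr ?subr0 ?if_same.
apply/ffunP => a; rewrite rem ffunE; case: ifPn => // /hasPn ag.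
have [//|/Pu [_ ag']] := eqVneq (u a) 0; apply: u0.
apply/ffunP => l; apply/eqP; rewrite eq_le ag' leNgt.
by rewrite ag // mem_enum.
Qed.

Lemma gen_in a : gen a \in newgens a.1 \/ ~~ valid a.
Proof.
have [va|] := boolP (valid a); [left|by right].
by apply: vbasis_mem; apply: mem_nth; rewrite size_tuple.
Qed.

(** In a relation of degree [g], the terms with a generator of degree exactly
    [g] sum to a new element that is also decomposable, hence to 0, and they are
    linearly independent. *)
Lemma cover_minimal g u : cover g u -> cover_map u = 0 ->
  forall a, boxdeg a.1 = g -> u a = 0.
Proof.
move=> Pu; rewrite /cover_map (bigID (fun a : A => boxdeg a.1 == g)) /=.
set old := (X in _ + X) => /eqP; rewrite addr_eq0 => /eqP newE a ag.
have boxI d d' : boxdeg d = boxdeg d' -> d = d'.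
  move=> /ffunP dd; apply/ffunP => l; apply: val_inj.
  by have := dd l; rewrite !ffunE => -[].
have new0 : \sum_(c : A | boxdeg c.1 == g) (u c : K) *: gen c = 0.
  apply/eqP; rewrite -memv0 -(capv_diff (B g) (decomposable g)) memv_cap.
  apply/andP; split.
    rewrite -ag -/(newgens a.1); apply: memv_suml => c /eqP /boxI <-.
    have [->|/Pu[vc _]] := eqVneq (u c) 0; first by rewrite scale0r mem0v.
    by apply: memvZ; case: (gen_in c) => //; rewrite vc.
  rewrite newE memvN; apply: memv_suml => c cg.
  have [->|/Pu[vc lec]] := eqVneq (u c) 0; first by rewrite scale0r mem0v.
  apply: memvZ.
  have [k ck] : exists k, boxdeg c.1 k < g k.
    apply: contrapT => nk; move/eqP: cg; apply; apply/ffunP => k; apply/eqP.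
    by rewrite eq_le lec leNgt; apply/negP => ?; apply: nk; exists k.
  apply: (subvP (sumv_sup k isT (subvv _))).
  apply: (@subvP _ _ (B (boxdeg c.1))); last first.
    case: (gen_in c) => [|/negP//]; apply: subvP; exact: diffvSl.
  apply: (vfam_mono BS) => l.
  have [->|lk] := eqVneq l k; last by rewrite sub_unitdeg_ne.
  by rewrite sub_unitdeg_id lerBrDr lezD1.
have [//|/Pu[va _]] := eqVneq (u a) 0.
have fr : free (vbasis (newgens a.1)) by exact: basis_free (vbasisP _).
have dimR : (\dim (newgens a.1) <= R)%N by exact: dimvS (subvf _).
pose c (r : 'I_(\dim (newgens a.1))) : K := u (a.1, widen_ord dimR r).
move/freeP: fr => /(_ c) c0.
have {}c0 := c0 _ (Ordinal va : 'I_(\dim (newgens a.1))).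
have <- : c (Ordinal va) = u a.
  by congr (u _); apply: injective_projections => //; exact: val_inj.
apply: c0; rewrite -[RHS]new0 [RHS]big_mkcond /=.
rewrite (eq_bigr (fun a' : A => if boxdeg a'.1 == g then
  (u (a'.1, a'.2) : K) *: gen (a'.1, a'.2) else 0)); last by case.
rewrite -(pair_bigA _ (fun d r => if boxdeg d == g then
  (u (d, r) : K) *: gen (d, r) else 0)) /= (bigD1 a.1) //= ag eqxx.
rewrite [X in _ = _ + X]big1 ?addr0; last first.
  move=> d da; apply: big1 => r _; case: eqP => // dg.
  by case/eqP: da; apply: boxI; rewrite dg.
rewrite /gen /=.
have -> : \sum_(r < R) (u (a.1, r) : K) *: (vbasis (newgens a.1))`_r =
    \sum_(r < R | (r < \dim (newgens a.1))%N)
      (u (a.1, r) : K) *: (vbasis (newgens a.1))`_r.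
  rewrite [RHS]big_mkcond; apply: eq_bigr => r _; case: ltnP => // rd.
  by rewrite nth_default ?scaler0 // size_tuple.
rewrite (big_ord_narrow dimR); exact: eq_bigr.
Qed.

(** A generator is not a combination of elements of smaller degree, so it gives
    a class in homological degree 0. *)
Lemma gen_not_exact a : valid a -> ~ exact_id (vfam B) (boxdeg a.1) 0.
Proof.
move=> va eB; have := gen_in a; rewrite va => -[] // ga.
have Ba : vfam B (boxdeg a.1) (gen a) by exact: (subvP (diffvSl _ _)) ga.
have [||w Xw dw] := eB (kone s (gen a)).
- by apply/kmem0P; [exact: vfam_subgrp|exists (gen a)].
- by apply: kd_kone; case: (idT T).
have [|y By gE] := @kone_bound_out _ _ e T (@idops 'I_n T) (vfam B) s
  (boxdeg a.1) (gen a) (vfam_subgrp B) (idT T).1 (enum_uniq _).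
  by exists w.
have : gen a \in (newgens a.1 :&: decomposable (boxdeg a.1))%VS.
  rewrite memv_cap ga gE big_enum /=.
  by apply/memv_sumP; exists y => // k _; exact: By.
rewrite capv_diff memv0; apply/negP.
apply: (free_not0 (basis_free (vbasisP (newgens a.1)))).
by apply: mem_nth; rewrite size_tuple.
Qed.

(** Restricted to [J], the cover is the direct sum over its generators of the
    truncations of [J] above the degree of the generator. *)
Lemma restr_cover_exact (J : pred G) b i :
  (forall a, valid a ->
     exact_id (trunc (degfam J) (boxdeg a.1) s) b i) ->
  exact_id (restr J cover) b i.
Proof.
move=> eJ.
pose X' (a : A) : gfam G K^o :=
  fun g c => trunc (degfam J) (boxdeg a.1) s g c /\ (~~ valid a -> c = 0).
pose pr (a : A) (g : G) (u : F) : K^o := u a.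
pose inj (a : A) (g : G) (c : K^o) : F :=
  [ffun a' => if a' == a then c else 0].
have H := @exact_decomposition _ _ e F K^o (@idops 'I_n F) (@idops 'I_n K^o) A
  (index_enum A) (restr J cover) X' pr inj.
apply: H => //.
- exact: restr_subgrp cover_subgrp.
- by move=> a g u v; rewrite /pr !ffunE.
- move=> a g u v; apply/ffunP => a'; rewrite !ffunE.
  by case: ifP => //; rewrite subr0.
- move=> a g u [Pu u0]; split.
    split=> [Jg|l _]; first by rewrite /pr u0 ?ffunE.
    move=> gl; apply/eqP; apply: contraTT gl => /Pu[_ /(_ l)].
    by rewrite leNgt.
  by move=> va; apply/eqP; apply: contraNT va => /Pu[].
- move=> a g c [[Jc cd] cv]; split.
    move=> a'; rewrite ffunE.
    case: (eqVneq a' a) => [->|]; last by rewrite eqxx.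
    move=> c0; split; first by apply: contraNT c0 => /cv ->.
    move=> l; rewrite leNgt; apply: contraNN c0 => /cd -> //.
    by rewrite mem_enum.
  move=> /Jc ->; apply/ffunP => a'; rewrite !ffunE; exact: if_same.
- move=> d u _ _; apply/ffunP => a; rewrite sum_ffunE.
  rewrite (bigD1 a) //= !ffunE eqxx big1 ?addr0 // => a' a'a.
  by rewrite ffunE eq_sym (negPf a'a).
move=> a; have [va|va] := boolP (valid a).
  apply: (exact_local (X := trunc (degfam J) (boxdeg a.1) s)); last exact: eJ.
  by move=> h v _ _; rewrite /X' va; split=> [?|[]//].
apply: exact_zero => //; last by move=> h v _ _ [_]; exact.
move=> g; have [t0 tB] := trunc_subgrp (degfam_subgrp J) (boxdeg a.1) s g.
split=> [|u v [tu u0] [tv v0]]; first by split.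
by split; [exact: tB|move=> /[dup] /u0 -> /v0 ->; rewrite subrr].
Qed.

End Cover.
Section Core.
Variable J : pred G.
Hypothesis JS : forall g k, J (g - e k) -> J g.
Hypothesis J_neg : forall (g : G) k, g k < 0 -> ~~ J g.

(** Restricting to [J] amounts to intersecting with its ideal.  In the induction
    the cover accounts for [j = 0], and its kernel carries the classes of [B] of
    positive homological degree, shifted down by one. *)
Theorem exact_restr (m : nat) (T : vectType K) (B : G -> {vspace T}) (N : nat)
    (b : G) :
  (forall g k, (B (g - e k) <= B g)%VS) ->
  (forall (g : G) k, g k < 0 -> B g = 0%VS) ->
  (forall g : G, B g = B [ffun l => Num.min (g l) N%:Z]) ->
  (forall (i j : nat) (c d : G), (i + j)%N = m ->
     (forall l, Num.max (c l) (d l) = b l) ->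
     exact_id (degfam J) c i%:Z \/ exact_id (vfam B) d j%:Z) ->
  exact_id (restr J (vfam B)) b m%:Z.
Proof.
have [M] := ubnP m; elim: M m T B => // M IH m T B lem BS B_neg B_cap eJB.
pose FT : vectType K :=
  {ffun {ffun 'I_n -> 'I_N.+1} * 'I_(\dim {:T}) -> K^o}.
set P := @cover T B N; set f := @cover_map T B N.
have fB : morphB f by exact: cover_mapB.
have sP := @cover_subgrp T B N; have SP := @cover_stable T B N.
have eP : exact_id (restr J P) b m%:Z.
  apply: restr_cover_exact => a va; apply: exact_trunc.
  - exact: degfam_subgrp.
  - exact: degfam_stable.
  - by move=> g v Jv [k /J_neg /Jv].
  - exact: enum_uniq.
  - exact: enum_uniq.
  - by [].
  move=> c _ cb; case: (eJB m 0%N c (boxdeg a.1)) => //.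
  - by rewrite addn0.
  - by move=> l; apply: cb; rewrite mem_enum.
  - by move/(gen_not_exact va).
have /choice [B' B'E] : forall g, exists V : {vspace FT},
    forall u, u \in V <-> P g u /\ f u = 0.
  move=> g; apply: vspace_of_pred.
    by split; [exact: cover0|exact: cover_map0].
  move=> c u v [Pu fu] [Pv fv]; split; first exact: cover_subspace.
  by rewrite /f cover_linear -/f fu fv scaler0 addr0.
have ZE J' g u : restr J' (vfam B') g u <-> restr J' P g u /\ f u = 0.
  by rewrite /restr /vfam B'E; tauto.
have eZ : exact_id (restr J (vfam B')) b (m%:Z - 1).
  have xB k : morphB (@idops 'I_n FT k) by [].
  case: m lem eJB {eP} => [|m] lem eJB.
    apply: exact_neg => //; exact: restr_subgrp (vfam_subgrp B').
  have -> : m.+1%:Z - 1 = m%:Z by lia.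
  apply: (IH m) => //.
  - move=> g k; apply/subvP => u /B'E [Pu fu]; apply/B'E; split=> //.
    exact: SP Pu.
  - move=> g k gk; apply/eqP; rewrite -subv0; apply/subvP => u /B'E[Pu _].
    by rewrite memv0; apply/eqP; exact: cover_neg gk Pu.
  - move=> g; apply/eqP; rewrite eqEsubv; apply/andP.
    by split; apply/subvP => u /B'E[Pu fu]; apply/B'E; split=> //;
      have [] := cover_cap B g u; [move=> + _|move=> _]; exact.
  move=> i j c d ij cd; case: (eJB i j.+1 c d) => //; first by rewrite addnS ij.
    by left.
  move=> eBd; right => z Zz dz.
  have eBd' : exact_id (vfam B) d (j%:Z + 1) by rewrite -PoszD addn1.
  have sub := @exact_sub_boundary _ _ e _ _ (@idops 'I_n _) (@idops 'I_n _) f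
    (vfam B') P (vfam B).
  (* A cycle of the kernel bounds in the cover: by acyclicity when [j > 0], by
     minimality when [j = 0].  Exactness of [B] pulls the bounding chain back. *)
  have bP : exists2 y, kmem e P d (j%:Z + 1) y & kd e (@idops 'I_n _) y = z.
    case: j ij eBd eBd' Zz => [|j] _ _ _ Zz.
      have /kmem0P [|u Bu ->] := Zz; first exact: vfam_subgrp.
      have /B'E [Pu fu] := Bu.
      by apply: cover_boundary => //; exact: cover_minimal Pu fu.
    apply: cover_exact dz => //; apply: kmem_ext Zz => h v.
    by rewrite /vfam B'E => -[].
  have [y Py dy] := bP.
  apply: sub Py dy => //; try exact: ops_id.
  - by move=> g u; exact: cover_map_in.
  - by move=> g v; exact: cover_map_onto.
have mE : m%:Z = m%:Z - 1 + 1 by rewrite subrK.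
have quo := @exact_quotient _ _ e _ _ (@idops 'I_n _) (@idops 'I_n _) f
  (restr J (vfam B')) (restr J P) (restr J (vfam B)).
rewrite mE in eP *; apply: quo eZ eP => //.
- exact: restr_subgrp.
- exact: restr_stable.
- move=> g u [Pu u0]; split; first exact: cover_map_in.
  by move=> /u0 ->; exact: cover_map0.
- move=> g v [/(cover_map_onto B_neg B_cap) [u Pu uE] v0].
  have [Jg|/v0 ->] := boolP (J g); first by exists u => //; split; rewrite ?Jg.
  exists 0; last exact: cover_map0.
  by split=> //; exact: cover0.
Qed.

End Core.

End Product.

(** * Sums of monomial ideals *)

Section Union.
Variables (K : fieldType) (n : nat).
Local Notation G := (zdeg n).
Local Notation e := (@unitdeg n).
Local Notation s := (enum 'I_n).
Local Notation exact_id X := (exact_at e (@idops 'I_n _) X s).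
Local Notation degfam := (@degfam K n).

Variables J L : pred G.
Hypothesis JS : forall g k, J (g - e k) -> J g.
Hypothesis LS : forall g k, L (g - e k) -> L g.

(** The sum is a quotient of the direct sum [Y] by the antidiagonal copy [Z] of
    the intersection. *)
Lemma exact_mayer_vietoris b i : exact_id (degfam (predI J L)) b i ->
  exact_id (degfam J) b (i + 1) -> exact_id (degfam L) b (i + 1) ->
  exact_id (degfam (predU J L)) b (i + 1).
Proof.
move=> eI eJ eL.
pose P : zmodType := (K^o * K^o)%type.
pose f (u : P) : K^o := u.1 + u.2.
pose Y : gfam G P := fun g u => degfam J g u.1 /\ degfam L g u.2.
pose Z : gfam G P := fun g u => Y g u /\ f u = 0.
have fB : morphB f by move=> u v; rewrite /f /= opprD addrACA.
have sY : subgrp Y.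
  move=> g; split; first by split.
  move=> [u v] [u' v'] [/= Ju Lv] [/= Ju' Lv']; split.
    by case: (degfam_subgrp K J g) => _; exact.
  by case: (degfam_subgrp K L g) => _; exact.
have sZ : subgrp Z.
  move=> g; have [Y0 YB] := sY g; split; first by split; rewrite /f //= addr0.
  move=> u v [Yu fu] [Yv fv]; split; first exact: YB.
  by rewrite fB fu fv subrr.
have eZ : exact_id Z b i.
  have dec := @exact_decomposition _ _ e P K^o (@idops 'I_n _) (@idops 'I_n _)
    unit [:: tt] Z (fun=> degfam (predI J L)) (fun _ _ u => u.1)
    (fun _ _ c => (c, - c)).
  apply: dec => //.
  - by move=> _ g u v; congr pair; exact: opprD.
  - move=> _ g u [[Ju Lu] /eqP]; rewrite /f addr_eq0 => /eqP uE.
    rewrite /degfam /= negb_and => /orP[/Ju //|/Lu u0].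
    by rewrite uE u0 oppr0.
  - move=> _ g c c0; split; last by rewrite /f /= subrr.
    split=> /= ng; rewrite c0 ?oppr0 //= negb_and ng ?orbT //.
  - move=> d u _ [_ /eqP]; rewrite /f addrC addr_eq0 => /eqP uE.
    by rewrite big_seq1 -uE -surjective_pairing.
have eY : exact_id Y b (i + 1).
  have dec := @exact_decomposition _ _ e P K^o (@idops 'I_n _) (@idops 'I_n _)
    bool (index_enum _) Y (fun a => degfam (if a then J else L))
    (fun a _ u => if a then u.1 else u.2)
    (fun a _ c => if a then (c, 0) else (0, c)).
  apply: dec => //.
  - by case.
  - by case=> g u v /=; congr pair; rewrite /= ?subr0.
  - by case=> g u [].
  - by case=> g c c0; split.
  - move=> d [u v] _ _; rewrite big_bool /=.
    by congr pair; rewrite /= ?addr0 ?add0r.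
  - by case.
have quo := @exact_quotient _ _ e _ _ (@idops 'I_n _) (@idops 'I_n _) f
  Z Y (degfam (predU J L)).
apply: quo eZ eY => //.
- by move=> g k [u v] [/= Ju Lv]; split=> /= ng; [apply: Ju|apply: Lv];
    apply: contra ng; [exact: JS|exact: LS].
- move=> g [u v] [/= Ju Lv]; rewrite /degfam /= negb_or => /andP[/Ju nj /Lv nl].
  by rewrite /f /= nj nl addr0.
- move=> g c c0; have [Jg|Jg] := boolP (J g).
    by exists (c, 0); [split=> //=; rewrite /degfam Jg|rewrite /f /= addr0].
  exists (0, c); last by rewrite /f /= add0r.
  by split=> //= Lg; apply: c0; rewrite /= negb_or Jg.
Qed.

Hypothesis J_neg : forall (g : G) k, g k < 0 -> ~~ J g.
Hypothesis L_neg : forall (g : G) k, g k < 0 -> ~~ L g.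

(** The cap bounds the degrees of the generators of [L]. *)
Theorem exact_union (N m : nat) (b : G) :
  (forall g : G, L g = L [ffun l => Num.min (g l) N%:Z]) ->
  (forall (i j : nat) (c d : G), (i + j).+1 = m ->
     (forall l, Num.max (c l) (d l) = b l) ->
     exact_id (degfam J) c i%:Z \/ exact_id (degfam L) d j%:Z) ->
  exact_id (degfam J) b m%:Z -> exact_id (degfam L) b m%:Z ->
  exact_id (degfam (predU J L)) b m%:Z.
Proof.
move=> L_cap eJL eJ eL.
have mE : m%:Z = m%:Z - 1 + 1 by rewrite subrK.
rewrite mE in eJ eL *; apply: exact_mayer_vietoris eJ eL.
case: m eJL {mE} => [|m] eJL.
  by apply: exact_neg => //; exact: degfam_subgrp.
have -> : m.+1%:Z - 1 = m%:Z by lia.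
pose B (g : G) : {vspace K^o} := (if L g then fullv else 0)%VS.
have BE (g : G) u : vfam B g u <-> degfam L g u.
  rewrite /vfam /B /degfam; case: (L g); rewrite ?memvf ?memv0.
    by split.
  by split=> [/eqP ->//|->].
apply: (exact_local (X := restr J (vfam B))).
  move=> g u _ _; rewrite /restr BE /degfam /= negb_and.
  split=> [[Lu Ju]|u0]; first by case/orP.
  by split=> ng; apply: u0; rewrite ng ?orbT.
apply: (@exact_restr _ _ J JS J_neg m _ B N) => //.
- move=> g k; rewrite /B; case: ifP => [/LS ->|_]; first exact: subvv.
  exact: sub0v.
- by move=> g k /L_neg /negPf; rewrite /B => ->.
- by move=> g; rewrite /B L_cap.
move=> i j c d ij cd; case: (eJL i j c d) => //; first by rewrite ij.
  by left.
by move=> eLd; right; apply: exact_local eLd => g u _ _; rewrite BE.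
Qed.

End Union.

(** * Division by variables in projective modules *)

Section Division.
Variables (K : fieldType) (n : nat).
Local Notation S := {mpoly K[n]}.
Local Notation G := (zdeg n).
Local Notation e := (@unitdeg n).
Local Notation s := (enum 'I_n).

Definition mulX (T : lmodType S) (k : 'I_n) (u : T) : T := 'X_k *: u.

Lemma mulX_ops (T : lmodType S) : ops (@mulX T).
Proof.
split=> [k u v|k l u]; first exact: scalerBr.
by rewrite /mulX !scalerA mulrC.
Qed.

Definition division (T : lmodType S) (D : 'I_n -> T -> T) : Prop :=
  [/\ forall k, morphB (D k),
      forall k l u, k != l -> D k (mulX l u) = mulX l (D k u) &
      forall k u, D k (mulX k u) = u].

Section DivisionExact.
Variables (T : lmodType S) (D : 'I_n -> T -> T) (X : gfam G T).
Hypotheses (DT : division D) (sX : subgrp X) (Xx : stable e (@mulX T) X).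
Hypothesis XD : forall k g u, X g u -> X (g - e k) (D k u).

Lemma division_exact g i : i != 0 -> exact_at e (@mulX T) X s g i.
Proof.
case: DT => DB Dx Dxx i0.
have H := @exact_division _ _ e T (@mulX T) X (fun k _ => D k) (mulX_ops T) sX
  Xx (fun k _ => DB k).
apply: H => //; last exact: enum_uniq.
- by move=> k l _ u; exact: Dx.
- by move=> k h u _; exact: Dxx.
Qed.

Lemma division_boundary g u : X g u ->
  remainder (@mulX T) (fun k (_ : G) => D k) s g u = 0 ->
  exists2 w : kos T s, kmem e X g 1 w & kd e (@mulX T) w = kone s u.
Proof.
case: DT => DB _ _; apply: kone_bound_division => //; first exact: mulX_ops.
Qed.
End DivisionExact.

Definition divX (k : 'I_n) (p : S) : S :=
  \sum_(m <- msupp p | m k != 0) p@_m *: 'X_[m - U_(k)].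

Lemma mcoeff_divX k p m : (divX k p)@_m = p@_(m + U_(k)).
Proof.
rewrite /divX big_mkcond raddf_sum /= [in RHS](mpolyE p) raddf_sum /=.
apply: eq_bigr => m' _; rewrite mcoeffZ mcoeffX.
have [mk|mk] := boolP (m' k != 0)%N.
  rewrite mcoeffZ mcoeffX; congr (_ * (nat_of_bool _)%:R).
  apply/eqP/eqP => [<-|->]; last by rewrite addmK.
  rewrite submK //; apply/mnm_lepP => l; rewrite mnm1E.
  by case: eqP => // <-; rewrite lt0n.
rewrite mcoeff0; case: eqP => [m'E|]; last by rewrite mulr0.
by move: mk; rewrite m'E mnmDE mnm1E eqxx addn1.
Qed.

Lemma mcoeff_mulX (k : 'I_n) (p : S) m :
  ('X_k * p)@_m = if m k == 0%N then 0 else p@_(m - U_(k)).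
Proof.
case: ifPn => mk.
  rewrite mcoeffM big1 // => -[m1 m2] /= /eqP mE.
  rewrite mcoeffX; case: eqP => [m1E|]; last by rewrite mul0r.
  have := congr1 (fun m' : 'X_{1..n} => m' k) mE.
  by rewrite /= mnmDE -m1E mnm1E eqxx (eqP mk).
rewrite mulrC -(mcoeffMX p U_(k) (m - U_(k))) addmC submK //.
apply/mnm_lepP => l; rewrite mnm1E.
by case: eqP => // <-; rewrite lt0n.
Qed.

Lemma divXB k : morphB (divX k).
Proof. by move=> p q; apply/mpolyP => m; rewrite !(mcoeff_divX, mcoeffB). Qed.

Lemma divX_mulX_ne (k l : 'I_n) p : k != l ->
  divX k ('X_l * p) = 'X_l * divX k p.
Proof.
move=> kl; apply/mpolyP => m; rewrite mcoeff_divX !mcoeff_mulX mcoeff_divX.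
rewrite mnmDE mnm1E (negPf kl) addn0; case: ifPn => // ml.
congr (p@__); apply/mnmP => j; rewrite !(mnmDE, mnmBE, mnm1E).
by have [<-|] := eqVneq l j; rewrite ?(negPf kl) ?subn0 ?addn0.
Qed.

Lemma divX_mulX (k : 'I_n) p : divX k ('X_k * p) = p.
Proof.
apply/mpolyP => m; rewrite mcoeff_divX mcoeff_mulX mnmDE mnm1E eqxx addn1 /=.
by rewrite addmK.
Qed.

Lemma divX_division : @division S^o divX.
Proof.
split=> [k|k l u kl|k u].
- exact: divXB.
- exact: divX_mulX_ne.
- exact: divX_mulX.
Qed.

Lemma divX_row_division r :
  @division 'rV[S]_r (fun k => map_mx (divX k)).
Proof.
split=> [k u v|k l u kl|k u]; apply/rowP => j; rewrite !mxE.
- exact: divXB.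
- exact: divX_mulX_ne.
- exact: divX_mulX.
Qed.

(** Without the multiples of the variables only the constant term is left. *)
Lemma mcoeff_remainder r (g : G) p m :
  (remainder (@mulX S^o) (fun k (_ : G) => divX k) r g p)@_m =
  if has (fun k => m k != 0)%N r then 0 else p@_m.
Proof.
elim: r p => [//|k r IH] p /=; rewrite IH mcoeffB mcoeff_mulX mcoeff_divX.
have [mk|mk] := eqVneq (m k) 0%N; first by rewrite subr0.
rewrite submK ?subrr ?if_same //.
apply/mnm_lepP => l; rewrite mnm1E; case: eqP => // <-; by rewrite lt0n.
Qed.

Lemma remainder_eq0 (g : G) p : p@_0 = 0 ->
  remainder (@mulX S^o) (fun k (_ : G) => divX k) s g p = 0.
Proof.
move=> p0; apply/mpolyP => m; rewrite mcoeff_remainder mcoeff0.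
case: ifPn => // /hasPn m0; suff -> : m = 0%MM by [].
by apply/mnmP => k; rewrite mnm0E; apply/eqP/negPn; apply: m0; rewrite mem_enum.
Qed.

Lemma row_remainder r rk (g : G) (u : 'rV[S]_rk) j :
  (remainder (@mulX 'rV[S]_rk) (fun k (_ : G) => map_mx (divX k)) r g u) 0 j =
  remainder (@mulX S^o) (fun k (_ : G) => divX k) r g (u 0 j).
Proof. by elim: r u => [//|k r IH] u /=; rewrite IH !mxE. Qed.

Lemma row_boundary rk (X : gfam G 'rV[S]_rk) g u :
  subgrp X -> stable e (@mulX _) X ->
  (forall k g u, X g u -> X (g - e k) (map_mx (divX k) u)) ->
  X g u -> (forall j, (u 0 j)@_0 = 0) ->
  exists2 w : kos _ s, kmem e X g 1 w & kd e (@mulX _) w = kone s u.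
Proof.
move=> sX Xx XD Xu u0; apply: (division_boundary (divX_row_division rk)) => //.
by apply/rowP => j; rewrite row_remainder remainder_eq0 ?mxE.
Qed.

Section Projective.
Variable P : lmodType S.
Import finmap monalg.
Local Notation M := (monalg.malg P S).
Local Notation supp := (@monalg.msupp P S).
Local Notation coef := (@monalg.mcoeff P S).

(** The free module on the elements of [P], its evaluation onto [P], and
    coefficientwise division on it. *)
Definition malg_sum (g : M) : P := \sum_(x <- supp g) coef x g *: x.

Lemma malg_sumE (d : {fset P}) (g : M) : (supp g `<=` d)%fset ->
  malg_sum g = \sum_(x <- d) coef x g *: x.
Proof.
move=> sub; apply: big_fset_incl => // x _ /monalg.mcoeff_outdom ->.
by rewrite scale0r.
Qed.

Lemma malg_sum_linear : linear malg_sum.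
Proof.
move=> c u v; pose d := (supp u `|` supp v `|` supp (c *: u + v))%fset.
rewrite !(@malg_sumE d); try by
  apply/fsubsetP => x xu; rewrite !in_fsetU xu ?orbT.
rewrite scaler_sumr -big_split; apply: eq_bigr => x _ /=.
by rewrite monalg.mcoeffD monalg.mcoeffZ scalerDl scalerA.
Qed.

HB.instance Definition _ :=
  GRing.isLinear.Build S M P _ malg_sum malg_sum_linear.

Lemma malg_sum_onto x : malg_sum (monalg.mkmalgU x 1) = x.
Proof.
rewrite (@malg_sumE [fset x]%fset) ?monalg.msuppU_le // big_seq_fset1.
by rewrite monalg.mcoeffUU scale1r.
Qed.

Definition malg_div (k : 'I_n) (g : M) : M :=
  monalg.mkmalg [fsfun x in supp g => divX k (coef x g)].

Lemma mcoeff_malg_div k g x : coef x (malg_div k g) = divX k (coef x g).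
Proof.
rewrite /malg_div monalg.mcoeffE; case: ifPn => // xg.
by rewrite (monalg.mcoeff_outdom xg) (morphB0 (divXB k)).
Qed.

Lemma malg_coef_mulX (k : 'I_n) (g : M) x :
  coef x (mulX k g) = 'X_k * coef x g.
Proof. exact: monalg.mcoeffZ. Qed.

Lemma malg_division : @division M malg_div.
Proof.
split=> [k u v|k l u kl|k u]; apply/monalg.malgP => x.
- by rewrite mcoeff_malg_div !monalg.mcoeffB !mcoeff_malg_div divXB.
- rewrite [RHS]malg_coef_mulX !mcoeff_malg_div malg_coef_mulX.
  exact: divX_mulX_ne.
- by rewrite mcoeff_malg_div malg_coef_mulX divX_mulX.
Qed.

(** A projective module is a direct summand of a free module; division passes
    to the summand along the splitting. *)
Lemma projective_division : projective P -> exists D, @division P D.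
Proof.
move=> projP.
have [|h hK] := projP M P malg_sum idfun.
  by move=> y; exists (monalg.mkmalgU y 1); exact: malg_sum_onto.
have [DB Dx Dxx] := malg_division.
exists (fun k u => malg_sum (malg_div k (h u))); split=> [k u v|k l u kl|k u].
- by rewrite linearB DB linearB.
- by rewrite /mulX linearZ Dx // linearZ.
- by rewrite /mulX linearZ Dxx hK.
Qed.
End Projective.

End Division.

(** * Dimension shifting along a resolution *)

Section Syzygies.
Variables (K : fieldType) (n : nat).
Local Notation S := {mpoly K[n]}.
Local Notation G := (zdeg n).
Local Notation e := (@unitdeg n).
Local Notation s := (enum 'I_n).
Local Notation exact_X X := (exact_at e (@mulX K n _) X s).

Variables (M : lmodType S) (P : nat -> lmodType S).
Variables (d : forall a, {linear P a.+1 -> P a}) (eps : {linear P 0%N -> M}).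

Definition target (a : nat) : lmodType S := if a is a'.+1 then P a' else M.

Definition arrow (a : nat) : {linear P a -> target a} :=
  match a return {linear P a -> target a} with
  | 0 => eps
  | a'.+1 => d a'
  end.

Variable Y : forall a, gfam G (P a).
Hypothesis sY : forall a, subgrp (@Y a).
Hypothesis Yx : forall a, stable e (@mulX K n _) (@Y a).

(** The grading is the one of the image; by [syzygy_ker] it is also the one
    induced by the ambient module. *)
Definition syzygy (a : nat) : gfam G (target a) :=
  fun g v => exists2 u, Y g u & arrow a u = v.

Hypothesis syzygy_ker : forall a g u,
  syzygy (a := a.+1) g u <-> Y g u /\ arrow a u = 0.
Hypothesis Y_exact : forall a g (i : int), i != 0 -> exact_X (@Y a) g i.

Let arrowB a : morphB (arrow a). Proof. by move=> u v; exact: linearB. Qed.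

Let arrow_mulX a k u : arrow a (mulX k u) = mulX k (arrow a u).
Proof. by rewrite /mulX linearZ. Qed.

Lemma exact_syzygy_pred a g (i : nat) :
  exact_X (syzygy (a := a.+1)) g i%:Z -> exact_X (syzygy (a := a)) g i.+1%:Z.
Proof.
move=> eZ; rewrite -addn1 PoszD.
have quo := @exact_quotient _ _ e _ _ (@mulX K n _) (@mulX K n _) (arrow a)
  (syzygy (a := a.+1)) (@Y a) (syzygy (a := a)).
apply: quo eZ _ => //; try exact: mulX_ops.
- exact: arrow_mulX.
- by move=> h u Yu; exists u.
- by apply: Y_exact; rewrite -PoszD addn1.
Qed.

Lemma exact_syzygy_iter a g (i : nat) :
  exact_X (syzygy (a := a)) g i%:Z -> exact_X (syzygy (a := 0)) g (i + a)%N%:Z.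
Proof.
elim: a i => [|a IH] i; first by rewrite addn0.
by move=> /exact_syzygy_pred /IH; rewrite addSnnS.
Qed.

Lemma exact_syzygy_succ a g (i : nat) :
  (forall u, syzygy (a := a.+1) g u ->
     exists2 w : kos _ s,
       kmem e (@Y a) g 1 w & kd e (@mulX K n _) w = kone s u) ->
  exact_X (syzygy (a := a)) g i.+1%:Z -> exact_X (syzygy (a := a.+1)) g i%:Z.
Proof.
move=> bnd eX z Zz dz.
rewrite -addn1 PoszD in eX.
have [y Yy dy] :
    exists2 y, kmem e (@Y a) g (i%:Z + 1) y & kd e (@mulX K n _) y = z.
  have [i0|i0] := eqVneq i 0%N.
    rewrite i0 in Zz *; have /kmem0P [|u Zu ->] := Zz; last exact: bnd.
    move=> h; split=> [|u v /syzygy_ker[Yu fu] /syzygy_ker[Yv fv]].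
      by apply/syzygy_ker; split; [case: (@sY a h)|exact: linear0].
    apply/syzygy_ker; split; last by rewrite arrowB fu fv subrr.
    by case: (@sY a h) => _; exact.
  apply: Y_exact dz; first by case: i i0 {eX Zz}.
  by apply: kmem_ext Zz => h v /syzygy_ker[].
have sub := @exact_sub_boundary _ _ e _ _ (@mulX K n _) (@mulX K n _) (arrow a)
  (syzygy (a := a.+1)) (@Y a) (syzygy (a := a)).
apply: sub eX Zz Yy dy => //; try exact: mulX_ops.
- exact: arrow_mulX.
- by move=> h u Yu; exists u.
Qed.

Lemma exact_syzygy_iter_succ a g (i : nat) :
  (forall a' u, syzygy (a := a'.+1) g u ->
     exists2 w : kos _ s,
       kmem e (@Y a') g 1 w & kd e (@mulX K n _) w = kone s u) ->
  exact_X (syzygy (a := 0)) g (i + a)%N%:Z -> exact_X (syzygy (a := a)) g i%:Z.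
Proof.
move=> bnd; elim: a i => [|a IH] i; first by rewrite addn0.
rewrite addnS -addSn => /IH; apply: exact_syzygy_succ; exact: bnd.
Qed.

End Syzygies.

Section ProjectiveDimension.
Variables (K : fieldType) (n : nat).
Local Notation S := {mpoly K[n]}.
Local Notation G := (zdeg n).
Local Notation e := (@unitdeg n).
Local Notation s := (enum 'I_n).

Definition allfam (T : zmodType) : gfam G T := fun _ _ => True.

(** The syzygy after the last nonzero module of the resolution is 0, and every
    step back along the resolution raises the homological degree by one. *)
Lemma projective_resolution_exact (M : lmodType S) l g (i : nat) :
  has_projective_resolution M l -> (l < i)%N ->
  exact_at e (@mulX K n M) (@allfam M) s g i%:Z.
Proof.
move=> [P [d [eps [projP [onto ex0 exS] P0]]]] li.
pose Y a : gfam G (P a) := @allfam (P a).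
have ker a h u : syzygy d eps Y (a := a.+1) h u <->
    Y a h u /\ arrow d eps a u = 0.
  have exE : arrow d eps a u = 0 <-> exists v, u = arrow d eps a.+1 v.
    by case: a u => [|a] u; [exact: ex0|exact: exS].
  split=> [[v _ vE]|[_ /exE[v ->]]]; last by exists v.
  by split=> //; apply/exE; exists v.
have Yex a h (j : int) : j != 0 -> exact_at e (@mulX K n _) (Y a) s h j.
  by have [D DP] := projective_division (projP a); apply: (division_exact DP).
have eS : exact_at e (@mulX K n _) (syzygy d eps Y (a := l.+1)) s g
    (i - l.+1)%N%:Z.
  have S0 h v : syzygy d eps Y (a := l.+1) h v <-> v = 0.
    split=> [[u _ <-]|->]; last by exists 0 => //; exact: linear0.
    by rewrite (P0 l.+1 (ltnSn l) u) linear0.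
  apply: exact_zero => [h|h v _ _ /S0 //|k]; last first.
    by case: (mulX_ops (target M P l.+1)).
  split; first exact/S0.
  by move=> u v /S0 -> /S0 ->; apply/S0; rewrite subrr.
have := exact_syzygy_iter (fun=> _) (fun=> _) ker Yex eS.
rewrite subnK // => H; apply: exact_local (H _ _) => //.
by move=> h v _ _; split=> // _; have [u uE] := onto v; exists u.
Qed.

End ProjectiveDimension.

(** * Generators of a minimal resolution *)

Section Homogeneous.
Variables (K : fieldType) (n : nat).
Local Notation S := {mpoly K[n]}.
Local Notation G := (zdeg n).
Local Notation e := (@unitdeg n).
Local Notation s := (enum 'I_n).
Implicit Types (p q : S) (z t : int).

Definition homz z p : Prop := forall m, p@_m != 0 -> (mdeg m)%:Z = z.

Lemma homogeneousP z p : homogeneous z p <-> homz z p.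
Proof.
split=> [[->|[d ->] /dhomogP hp] m|hp].
- by rewrite mcoeff0 eqxx.
- by rewrite -mcoeff_msupp => /hp ->.
have [->|p0] := eqVneq p 0; first by left.
right; exists (mdeg (mlead p)).
  by rewrite (hp (mlead p)) // -mcoeff_msupp mlead_supp.
apply/dhomogP => m; rewrite mcoeff_msupp => /hp hm.
apply/eqP; rewrite -eqz_nat hm (hp (mlead p)) // -mcoeff_msupp.
exact: mlead_supp.
Qed.

Lemma homz0 z : homz z 0. Proof. by move=> m; rewrite mcoeff0 eqxx. Qed.

Lemma homzB z p q : homz z p -> homz z q -> homz z (p - q).
Proof.
move=> hp hq m; rewrite mcoeffB; have [p0|/hp //] := eqVneq p@_m 0.
by rewrite p0 sub0r oppr_eq0 => /hq.
Qed.

Lemma homz_sum z (A : Type) (r : seq A) (F : A -> S) :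
  (forall a, homz z (F a)) -> homz z (\sum_(a <- r) F a).
Proof.
move=> hF; elim/big_ind: _ => //; first exact: homz0.
move=> p q hp hq; rewrite -[q]opprK; apply: homzB => //.
by rewrite -sub0r; apply: homzB => //; exact: homz0.
Qed.

Lemma homzM z t p q : homz z p -> homz t q -> homz (z + t) (p * q).
Proof.
move=> hp hq m pq; apply: contrapT => mzt; move/eqP: pq; apply.
rewrite mcoeffM big1 // => -[m1 m2] /= /eqP mE.
have [->|/hp h1] := eqVneq p@_m1 0; first by rewrite mul0r.
have [->|/hq h2] := eqVneq q@_m2 0; first by rewrite mulr0.
by case: mzt; rewrite mE mdegD PoszD h1 h2.
Qed.

Lemma homz_const z p : homz z p -> z != 0 -> p@_0 = 0.
Proof.
move=> hp z0; apply/eqP; apply: contraNT z0 => /hp <-.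
by rewrite mdeg0.
Qed.

Lemma homz_mulX z k p : homz (z - 1) p -> homz z ('X_k * p).
Proof.
move=> hp m; rewrite mcoeff_mulX; case: ifPn; first by rewrite eqxx.
move=> mk /hp; rewrite -(@submK _ U_(k)%MM m) ?addmK; last first.
  by apply/mnm_lepP => l; rewrite mnm1E; case: eqP => // <-; rewrite lt0n.
by rewrite mdegD mdeg1; lia.
Qed.

Lemma homz_divX z k p : homz z p -> homz (z - 1) (divX k p).
Proof.
by move=> hp m; rewrite mcoeff_divX => /hp <-; rewrite mdegD mdeg1; lia.
Qed.

Definition hcomp z p : S := if z is Posz d then pihomog mdeg d p else 0.

Lemma mcoeff_hcomp z p m :
  (hcomp z p)@_m = if (mdeg m)%:Z == z then p@_m else 0.
Proof.
case: z => d /=; last by rewrite mcoeff0.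
rewrite pihomogE raddf_sum /= eqz_nat; case: ifPn => [md|md].
  rewrite big_mkcond [in RHS](mpolyE p) raddf_sum /=; apply: eq_bigr => m' _.
  case: ifPn => // m'd; rewrite mcoeffZ mcoeffX.
  case: eqP => [m'm|]; last by rewrite mulr0.
  by rewrite m'm md in m'd.
apply: big1 => m' m'd; rewrite mcoeffZ mcoeffX.
by case: eqP => [m'm|]; rewrite ?mulr0 //; move: md; rewrite -m'm m'd.
Qed.

Lemma homz_hcomp z p : homz z (hcomp z p).
Proof.
by move=> m; rewrite mcoeff_hcomp; case: ifP => [/eqP -> //|_]; rewrite eqxx.
Qed.

Lemma hcomp_id z p : homz z p -> hcomp z p = p.
Proof.
move=> hp; apply/mpolyP => m; rewrite mcoeff_hcomp; case: eqP => // mz.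
by apply/esym/eqP; apply/negPn/negP => /hp.
Qed.

Lemma hcomp_sum z (A : Type) (r : seq A) (F : A -> S) :
  hcomp z (\sum_(a <- r) F a) = \sum_(a <- r) hcomp z (F a).
Proof.
apply/mpolyP => m; rewrite mcoeff_hcomp !(raddf_sum (mcoeff m)) /=.
case: ifPn => mz; first by apply: eq_bigr => a _; rewrite mcoeff_hcomp mz.
by rewrite big1 // => a _; rewrite mcoeff_hcomp (negPf mz).
Qed.

Lemma hcompM z t p q : homz t q -> hcomp z (p * q) = hcomp (z - t) p * q.
Proof.
move=> hq; apply/mpolyP => m; rewrite mcoeff_hcomp !mcoeffM.
have mdE (m1 m2 : 'X_{1..n < (mdeg m).+1}) : m == (m1 + m2)%MM ->
    (mdeg m)%:Z = (mdeg m1)%:Z + (mdeg m2)%:Z.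
  by move=> /eqP/(congr1 (@mdeg n)); rewrite mdegD -PoszD => H; congr Posz.
case: ifPn => mz.
  apply: eq_bigr => -[m1 m2] /= /mdE mE; rewrite mcoeff_hcomp.
  have [->|/hq h2] := eqVneq q@_m2 0; first by rewrite !mulr0.
  by case: eqP => // ne; case: ne; rewrite -(eqP mz) mE -h2 addrK.
apply/esym/big1 => -[m1 m2] /= /mdE mE; rewrite mcoeff_hcomp.
have [->|/hq h2] := eqVneq q@_m2 0; first by rewrite !mulr0.
case: eqP => [h1|]; last by rewrite mul0r.
by case/negP: mz; rewrite mE h1 h2 subrK.
Qed.

Definition tdeg (g : G) : int := \sum_l g l.

Lemma tdeg_sub (g : G) k : tdeg (g - e k) = tdeg g - 1.
Proof.
rewrite /tdeg (bigD1 k) //= [in RHS](bigD1 k) //= sub_unitdeg_id -!addrA.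
congr (_ + _); rewrite addrC; congr (_ - _).
by apply: eq_bigr => l lk; rewrite sub_unitdeg_ne.
Qed.

End Homogeneous.

Section MinimalResolution.
Variables (K : fieldType) (n : nat).
Local Notation S := {mpoly K[n]}.
Local Notation G := (zdeg n).
Local Notation e := (@unitdeg n).
Local Notation s := (enum 'I_n).
Local Notation exact_X X := (exact_at e (@mulX K n _) X s).

Variables (I : ideal S) (F : min_graded_resolution I).
Hypothesis I_comp : forall z f, I f -> I (hcomp z f).

Definition mgr_mod (a : nat) : lmodType S := 'rV[S]_(mgr_rank F a).

Definition mgr_map (a : nat) : {linear mgr_mod a.+1 -> mgr_mod a} :=
  mulmxr (mgr_diff F a).

Local Notation P a := 'rV[S]_(mgr_rank F a).
Local Notation eps := (mgr_aug F).
Variable j : int.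

(** The Z-grading enters through the total degree of the multidegree; the offset
    [j] makes every integer degree available at multidegree 0, also when there
    are no variables. *)
Definition gradquot : gfam G (quotmod I) :=
  fun g u => exists2 f, homz (j + tdeg g) f & u = quotmod_pi I f.

Definition gradfree (a : nat) : gfam G (mgr_mod a) :=
  fun g (v : P a) => forall k, homz (j + tdeg g - mgr_deg k) (v 0 k).

Lemma gradfree_subgrp a : subgrp (gradfree (a := a)).
Proof.
move=> g; split=> [k|u v hu hv k]; rewrite !mxE; first exact: homz0.
exact: homzB.
Qed.

Lemma gradfree_stable a : stable e (@mulX K n _) (gradfree (a := a)).
Proof.
move=> g k u hu l; rewrite mxE; apply: homz_mulX.
by have := hu l; rewrite tdeg_sub addrA (addrAC (j + tdeg g)).
Qed.

Lemma gradfree_divX a g k (u : P a) : gradfree g u ->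
  gradfree (g - e k) (map_mx (divX k) u).
Proof.
move=> hu l; rewrite mxE tdeg_sub addrA (addrAC (j + tdeg g)).
exact: homz_divX.
Qed.

Lemma gradfree_exact a g (i : int) : i != 0 -> exact_X (gradfree (a := a)) g i.
Proof.
apply: (division_exact (divX_row_division _ _ _)).
- exact: gradfree_subgrp.
- exact: gradfree_stable.
- by move=> k h u; exact: gradfree_divX.
Qed.

Local Notation arrow := (arrow (P := mgr_mod) mgr_map eps).
Local Notation syzygy a :=
  (syzygy (P := mgr_mod) mgr_map eps gradfree (a := a)).

Lemma resolution_ker a (u : P a) :
  arrow a u = 0 <-> exists v : P a.+1, u = v *m mgr_diff F a.
Proof.
have [_ ex0 exS] := mgr_resolution F.
by case: a u => [|a] u; [exact: ex0|exact: exS].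
Qed.

Lemma resolution_ker_const a (u : P a) k : arrow a u = 0 -> (u 0 k)@_0 = 0.
Proof.
move=> /resolution_ker[v ->]; rewrite mxE raddf_sum big1 //= => l _.
by rewrite rmorphM /= mgr_minimal mulr0.
Qed.

(** Exactness holds in each degree: replace a preimage by its homogeneous
    components. *)
Lemma gradfree_ker a g (u : P a) :
  syzygy a.+1 g u <-> gradfree g u /\ arrow a u = 0.
Proof.
have dh b k l : homz (mgr_deg k - mgr_deg l) (mgr_diff F b k l).
  exact/homogeneousP/mgr_diff_homog.
split=> [[v hv <-]|[hu /resolution_ker[v uE]]].
  split; last by apply/resolution_ker; exists v.
  move=> l; rewrite mxE; apply: homz_sum => k.
  have := homzM (hv k) (dh a k l).
  by rewrite addrA subrK.
exists (\row_k hcomp (j + tdeg g - mgr_deg k) (v 0 k)).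
  by move=> k; rewrite mxE; exact: homz_hcomp.
apply/rowP => l; rewrite /= -(hcomp_id (hu l)) uE !mxE hcomp_sum.
apply: eq_bigr => k _; rewrite mxE (hcompM _ _ (dh a k l)).
congr (hcomp _ _ * _).
by lia.
Qed.

Lemma gradfree_bound a u g : syzygy a.+1 g u ->
  exists2 w : kos _ s, kmem e (gradfree (a := a)) g 1 w &
    kd e (@mulX K n _) w = kone s u.
Proof.
move=> /gradfree_ker[hu u0]; apply: row_boundary => //.
- exact: gradfree_subgrp.
- exact: gradfree_stable.
- by move=> k h v; exact: gradfree_divX.
- by move=> k; exact: resolution_ker_const.
Qed.

Lemma quotmod_pi_sum (A : Type) (r : seq A) (f : A -> S) :
  quotmod_pi I (\sum_(a <- r) f a) = \sum_(a <- r) quotmod_pi I (f a).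
Proof.
apply: (big_morph (quotmod_pi I)); first exact: quotmod_piD.
by apply: (addrI (quotmod_pi I 0)); rewrite -quotmod_piD !addr0.
Qed.

Lemma quotmod_piZ a f : a *: quotmod_pi I f = quotmod_pi I (a * f).
Proof. exact: quotmod_piM. Qed.

Lemma syzygy0 g u : syzygy 0 g u <-> gradquot g u.
Proof.
have /choice [f fE] : forall k : 'I_(mgr_rank F 0), exists f,
    homz (mgr_deg k) f /\ eps (delta_mx 0 k) = quotmod_pi I f.
  by move=> k; have [f /homogeneousP hf fE] := mgr_aug_homog k; exists f.
have epsE (v : P 0) : eps v = quotmod_pi I (\sum_k v 0 k * f k).
  rewrite [in LHS](row_sum_delta v) linear_sum quotmod_pi_sum.
  by apply: eq_bigr => k _; rewrite linearZ (fE k).2 /= quotmod_piZ.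
split=> [[v hv <-]|[h hh ->]].
  exists (\sum_k v 0 k * f k); last exact: epsE.
  by apply: homz_sum => k; have := homzM (hv k) (fE k).1; rewrite subrK.
have [onto _ _] := mgr_resolution F.
have [v] := onto (quotmod_pi I h); rewrite epsE => /quotmod_piP Ivh.
exists (\row_k hcomp (j + tdeg g - mgr_deg k) (v 0 k)).
  by move=> k; rewrite mxE; exact: homz_hcomp.
rewrite /= epsE; apply/quotmod_piP.
suff -> : \sum_k (\row_k hcomp (j + tdeg g - mgr_deg k) (v 0 k)) 0 k * f k - h =
  hcomp (j + tdeg g) (\sum_k v 0 k * f k - h) by exact: I_comp.
rewrite -[in LHS](hcomp_id hh); apply/esym.
have hB p q : hcomp (j + tdeg g) (p - q) =
    hcomp (j + tdeg g) p - hcomp (j + tdeg g) q.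
  apply/mpolyP => m; rewrite mcoeffB !mcoeff_hcomp mcoeffB.
  by case: ifP => //; rewrite subr0.
rewrite hB hcomp_sum; congr (_ - _); apply: eq_bigr => k _.
by rewrite mxE (hcompM _ _ (fE k).1).
Qed.

Lemma tdeg0 : tdeg (0 : G) = 0.
Proof. by apply: big1 => l _; rewrite ffunE. Qed.

Lemma arrow_mulX a k (u : P a) : arrow a (mulX k u) = mulX k (arrow a u).
Proof. by rewrite /mulX linearZ. Qed.

Lemma syzygy_subgrp a : subgrp (syzygy a).
Proof.
move=> g; have [h0 hB] := @gradfree_subgrp a g.
split=> [|u v [u' hu <-] [v' hv <-]]; first by exists 0; rewrite ?linear0.
by exists (u' - v'); [exact: hB|rewrite linearB].
Qed.

(** Minimality makes the generators of the [a]-th module a basis of the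
    syzygies modulo the multiples of the variables. *)
Lemma generator_syzygy a :
  (exists k : 'I_(mgr_rank F a), mgr_deg k = j) <-> ~ exact_X (syzygy a) 0 0.
Proof.
have [xB _] := mulX_ops (mgr_mod a).
have [tB _] := mulX_ops (target (quotmod I) mgr_mod a).
split=> [[k kj] eX|neX].
  pose ek : P a := delta_mx 0 k.
  have hek : gradfree (0 : G) (ek : mgr_mod a).
    move=> l; rewrite mxE eqxx tdeg0 addr0 /=.
    have [->|lk] := eqVneq l k; last exact: homz0.
    rewrite kj subrr => m; rewrite mcoeff1.
    by have [->|] := eqVneq m 0%MM; rewrite ?mdeg0 ?eqxx.
  have [||w Xw dw] := eX (kone s (arrow a ek)).
  - apply/kmem0P; first exact: syzygy_subgrp.
    by exists (arrow a ek) => //; exists ek.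
  - exact: kd_kone.
  have [|y Sy ekE] := @kone_bound_out _ _ e _ (@mulX K n _) (syzygy a) s 0
    (arrow a ek) (@syzygy_subgrp a) tB (enum_uniq 'I_n).
    by exists w; [exact: Xw|exact: dw].
  have /choice [v vE] : forall l, exists v : P a, arrow a v = y l.
    by move=> l; have [v _ vE] := Sy l; exists v.
  have : arrow a (ek - \sum_(l <- s) mulX l (v l)) = 0.
    rewrite linearB linear_sum ekE; apply/eqP; rewrite subr_eq0; apply/eqP.
    by apply: eq_bigr => l _; rewrite arrow_mulX vE.
  move=> /(@resolution_ker_const a _ k).
  rewrite !mxE !eqxx summxE /= mcoeffB mcoeff1 !eqxx.
  rewrite raddf_sum big1 ?subr0 => [|l _] /=.
    by move/eqP; rewrite oner_eq0.
  by rewrite mxE mcoeff_mulX mnm0E.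
apply: contrapT => nk; apply: neX => z Zz _.
have /kmem0P [|u Su ->] := Zz; first exact: syzygy_subgrp.
have [v hv <-] := Su.
have [||w Yw dw] := @row_boundary K n (mgr_rank F a) (@gradfree a) 0 v
  (@gradfree_subgrp a) (@gradfree_stable a) _ hv.
- by move=> k h t; exact: gradfree_divX.
- move=> k; have := hv k; rewrite tdeg0 addr0 => /homz_const; apply.
  by rewrite subr_eq0; apply/eqP => jk; apply: nk; exists k.
exists (kmap e (fun=> arrow a) 0 w).
  by apply: kmap_kmem Yw => [h|h t Yt]; [exact: linear0|exists t].
rewrite -(@kmap_kd _ _ e _ _ (@mulX K n _) (fun=> arrow a) (@mulX K n _))
  ?dw ?kmap_kone //.
- by move=> h t t'; exact: linearB.
- by move=> h t t'; exact: linearB.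
- by move=> l h t _; exact: arrow_mulX.
Qed.

(** Minimality and acyclicity of free modules make both directions of the
    dimension shift available. *)
Theorem generator_exact a :
  (exists k : 'I_(mgr_rank F a), mgr_deg k = j) <-> ~ exact_X gradquot 0 a%:Z.
Proof.
rewrite generator_syzygy.
have E : exact_X (syzygy 0) 0 a%:Z <-> exact_X gradquot 0 a%:Z.
  by split; apply: exact_local => h v _ _; have := syzygy0 h v; tauto.
rewrite -E; apply: not_iff_compat; split=> H.
  exact: (exact_syzygy_iter gradfree_subgrp gradfree_stable gradfree_ker
    gradfree_exact (i := 0)).
apply: (exact_syzygy_iter_succ gradfree_subgrp gradfree_stable gradfree_ker
  gradfree_exact (i := 0)) => //.
by move=> a' u; exact: gradfree_bound.
Qed.

End MinimalResolution.

(** * Monomial ideals *)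

Section MonomialIdeals.
Variables (K : fieldType) (n : nat).
Local Notation S := {mpoly K[n]}.
Implicit Type I : ideal S.

Definition monomials (A : 'X_{1..n} -> Prop) : S -> Prop :=
  fun f => exists2 b, A b & f = 'X_[b].

Lemma ideal_sum I (T : eqType) (r : seq T) (F : T -> S) :
  (forall i, i \in r -> I (F i)) -> I (\sum_(i <- r) F i).
Proof.
move=> IF; rewrite big_seq; elim/big_ind: _ => //; first exact: ideal_mem0.
exact: ideal_memD.
Qed.

Lemma ideal_term I c m : I 'X_[m] -> I (c *: 'X_[m]).
Proof. by move=> Im; rewrite -mul_mpolyC; exact: ideal_memM. Qed.

Section Divisible.
Variable A : 'X_{1..n} -> Prop.
Let mem (f : S) : Prop :=
  forall m, f@_m != 0 -> exists2 b, A b & (b <= m)%MM.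

Fact divisible0 : mem 0. Proof. by move=> m; rewrite mcoeff0 eqxx. Qed.

Fact divisibleD f g : mem f -> mem g -> mem (f + g).
Proof.
move=> hf hg m; rewrite mcoeffD; have [f0|/hf //] := eqVneq f@_m 0.
by rewrite f0 add0r => /hg.
Qed.

Fact divisibleM a f : mem f -> mem (a * f).
Proof.
move=> hf m; apply: contraPP => nA; apply/negP/negPn/eqP.
rewrite mcoeffM big1 // => -[m1 m2] /= /eqP mE.
have [->|/hf[b Ab bm]] := eqVneq f@_m2 0; first by rewrite mulr0.
case: nA; exists b => //; rewrite mE; apply: lepm_trans bm _.
exact: lem_addl.
Qed.

Definition divisible_ideal : ideal S := Ideal divisible0 divisibleD divisibleM.
End Divisible.

(** The polynomials all of whose terms are multiples of generators form an
    ideal, which therefore contains the generated one. *)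
Lemma ideal_gen_monomialsP A f : ideal_gen (monomials A) f <->
  forall m, f@_m != 0 -> exists2 b, A b & (b <= m)%MM.
Proof.
split=> [|hf].
  move=> h; apply: (h (divisible_ideal A)) => _ [b Ab ->] /= m.
  rewrite mcoeffX; case: (eqVneq b _) => [<- _|_]; last by rewrite eqxx.
  by exists b; rewrite ?lepm_refl.
move=> J AJ; rewrite (mpolyE f); apply: ideal_sum => m.
rewrite mcoeff_msupp => /hf[b Ab bm]; apply: ideal_term.
by rewrite -(submK bm) mpolyXD; apply: ideal_memM; apply: AJ; exists b.
Qed.

Definition supported I : Prop :=
  forall f, I f <-> forall m, f@_m != 0 -> I 'X_[m].

Lemma mem_monomialP A m : ideal_gen (monomials A) 'X_[m] <->
  exists2 b, A b & (b <= m)%MM.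
Proof.
rewrite ideal_gen_monomialsP; split=> [h|[b Ab bm] m'].
  by apply: h; rewrite mcoeffX eqxx oner_eq0.
rewrite mcoeffX; case: (eqVneq m m') => [<- _|_]; last by rewrite eqxx.
by exists b.
Qed.

Lemma monomial_supported I : monomial_ideal I -> supported I.
Proof.
move=> [A IA] f; rewrite (IA f) ideal_gen_monomialsP.
by split=> h m /h; rewrite (IA 'X_[m]) mem_monomialP.
Qed.

Definition leset I (alpha : 'X_{1..n}) : 'X_{1..n} -> Prop :=
  fun b => I 'X_[b] /\ (b <= alpha)%MM.

Lemma ideal_leE I alpha :
  ideal_eq (ideal_le I alpha) (ideal_gen (monomials (leset I alpha))).
Proof.
move=> f; split=> h; rewrite /= => J AJ; apply: h => g.
  by case=> b [Ib ba ->]; apply: AJ; exists b.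
by case=> b [Ib ba] ->; apply: AJ; exists b.
Qed.

Lemma ideal_le_monomial I alpha : monomial_ideal (ideal_le I alpha).
Proof. by exists (leset I alpha); exact: ideal_leE. Qed.

Lemma ideal_le_supported I alpha : supported (ideal_le I alpha).
Proof. exact/monomial_supported/ideal_le_monomial. Qed.

Lemma ideal_le_monomialP I alpha m : ideal_le I alpha 'X_[m] <->
  exists b, [/\ I 'X_[b], (b <= alpha)%MM & (b <= m)%MM].
Proof.
rewrite (ideal_leE I alpha 'X_[m]) mem_monomialP.
by split=> [[b [? ?] ?]|[b [? ? ?]]]; exists b.
Qed.

Lemma ideal_le_sub I alpha f : ideal_le I alpha f -> I f.
Proof. by apply=> _ [b [Ib _ ->]]. Qed.

Lemma ideal_monomial_up I m m' : I 'X_[m] -> (m <= m')%MM -> I 'X_[m'].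
Proof. by move=> Im mm; rewrite -(submK mm) mpolyXD; exact: ideal_memM. Qed.

Lemma covering_monomialP I alpha beta m : covering_pair I alpha beta ->
  I 'X_[m] <-> ideal_le I alpha 'X_[m] \/ ideal_le I beta 'X_[m].
Proof.
move=> cov; split=> [|[|]]; try exact: ideal_le_sub.
rewrite (cov 'X_[m]) => -[f [g [If Ig fg]]].
have : ('X_[m] : S)@_m != 0 by rewrite mcoeffX eqxx oner_eq0.
rewrite {1}fg mcoeffD; have [f0|f0 _] := eqVneq f@_m 0.
  by rewrite f0 add0r => g0; right; exact: (ideal_le_supported _ _ _).1 Ig m g0.
by left; exact: (ideal_le_supported _ _ _).1 If m f0.
Qed.

Lemma supported_hcomp I z f : supported I -> I f -> I (hcomp z f).
Proof.
move=> sI If; apply/sI => m; rewrite mcoeff_hcomp; case: ifP => _.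
  by have := (sI f).1 If m.
by rewrite eqxx.
Qed.

Lemma proper_const I f : supported I -> ~ I 1 -> I f -> f@_0 = 0.
Proof.
move=> sI I1 If; apply/eqP; apply: contraPT I1 => f0.
by have := (sI f).1 If _ f0; rewrite mpolyX0 => h; apply.
Qed.

End MonomialIdeals.

(** * From the quotient ring to the multigraded strands of the ideal *)

Section QuotientIdeal.
Variables (K : fieldType) (n : nat).
Local Notation S := {mpoly K[n]}.
Local Notation G := (zdeg n).
Local Notation e := (@unitdeg n).
Local Notation s := (enum 'I_n).
Local Notation exact_X X := (exact_at e (@mulX K n _) X s).

Variables (I : ideal S) (Y : gfam G S^o).

Lemma quotmod_piB : @morphB S^o (quotmod I) (quotmod_pi I).
Proof.
move=> u v; apply: (addIr (quotmod_pi I v)).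
by rewrite -quotmod_piD !subrK.
Qed.

Hypothesis I0 : forall f, I f -> f@_0 = 0.
Hypotheses (sY : subgrp Y) (Yx : stable e (@mulX K n S^o) Y).
Hypothesis YD : forall k g u, Y g u -> Y (g - e k) (divX k u).

Definition idealfam : gfam G S^o := fun g u => Y g u /\ I u.
Definition quotfam : gfam G (quotmod I) :=
  fun g v => exists2 u : S, Y g u & v = quotmod_pi I u.

Let piX k (u : S^o) : quotmod_pi I (mulX k u) = mulX k (quotmod_pi I u).
Proof. by rewrite /mulX quotmod_piZ. Qed.

Let piK g (u : S^o) : idealfam g u <-> Y g u /\ quotmod_pi I u = 0.
Proof.
have pi0 : quotmod_pi I 0 = 0 by exact: morphB0 quotmod_piB.
rewrite -[in X in _ <-> X]pi0; split=> -[Yu].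
  by move=> Iu; split=> //; apply/quotmod_piP; rewrite subr0.
by move/quotmod_piP; rewrite subr0.
Qed.

Let Y_exact g (i : int) : i != 0 -> exact_X Y g i.
Proof. by apply: (division_exact (divX_division K n)). Qed.

(** The shift by one between S/I and I.  In homological degree 0 it uses that
    elements of a proper monomial ideal have no constant term, so that they
    bound in the Koszul complex of S. *)
Lemma exact_quotient_ideal g (i : nat) :
  exact_X quotfam g i.+1%:Z <-> exact_X idealfam g i%:Z.
Proof.
rewrite -addn1 PoszD; split=> [eX z Zz dz|eZ].
  have [y Yy dy] :
      exists2 y, kmem e Y g (i%:Z + 1) y & kd e (@mulX K n S^o) y = z.
    have [i0|i0] := eqVneq i 0%N.
      rewrite i0 in Zz *.
      have /kmem0P [|u [Yu Iu] ->] := Zz; last first.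
        apply: (division_boundary (divX_division K n)) => //.
        exact/remainder_eq0/I0.
      move=> h; have [Y0 YB] := sY h; split=> [|u v [Yu Iu] [Yv Iv]].
        by split=> //; exact: ideal_mem0.
      split; first exact: YB.
      by apply: ideal_memD => //; rewrite -mulN1r; exact: ideal_memM.
    apply: Y_exact dz; first by case: i i0 {eX Zz}.
    by apply: kmem_ext Zz => h v [].
  have sub := @exact_sub_boundary _ _ e S^o (quotmod I)
    (@mulX K n S^o) (@mulX K n (quotmod I)) (quotmod_pi I) idealfam Y quotfam.
  apply: sub eX Zz Yy dy => //; try exact: mulX_ops; try exact: quotmod_piB.
  - by move=> h u Yu; exists u.
  - by move=> h v [u Yu ->]; exists u.
have quo := @exact_quotient _ _ e S^o (quotmod I)
    (@mulX K n S^o) (@mulX K n (quotmod I)) (quotmod_pi I) idealfam Y quotfam.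
apply: quo eZ _ => //; try exact: mulX_ops; try exact: quotmod_piB.
- by move=> h u Yu; exists u.
- by move=> h v [u Yu ->]; exists u.
- by apply: Y_exact; rewrite -PoszD addn1.
Qed.

End QuotientIdeal.

Section Multidegrees.
Variables (K : fieldType) (n : nat).
Local Notation S := {mpoly K[n]}.
Local Notation G := (zdeg n).
Local Notation e := (@unitdeg n).
Local Notation s := (enum 'I_n).
Local Notation exact_id X := (exact_at e (@idops 'I_n _) X s).
Local Notation exact_X X := (exact_at e (@mulX K n _) X s).
Implicit Types (g : G) (p : S) (c : K^o).

Definition expon g : 'X_{1..n} := [multinom `|g l|%N | l < n].

Definition nneg g : bool := [forall l, 0 <= g l].

Lemma nnegP g : reflect (forall l, 0 <= g l) (nneg g).
Proof. exact: forallP. Qed.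

Lemma nneg_sub g k : nneg (g - e k) = nneg g && (1 <= g k).
Proof.
apply/nnegP/andP => [h|[/nnegP h gk] l].
  split; last by have := h k; rewrite sub_unitdeg_id; lia.
  by apply/nnegP => l; exact: le_trans (h l) (sub_unitdeg_le _ _ _).
have [->|lk] := eqVneq l k; first by rewrite sub_unitdeg_id; lia.
by rewrite sub_unitdeg_ne.
Qed.

Lemma expon_sub g k : nneg (g - e k) ->
  expon g = (U_(k) + expon (g - e k)%R)%MM.
Proof.
rewrite nneg_sub => /andP[/nnegP g0 gk]; apply/mnmP => l.
rewrite !mnmE; have [<-|kl] := eqVneq k l.
  by rewrite sub_unitdeg_id; have := g0 k; lia.
by rewrite sub_unitdeg_ne // eq_sym.
Qed.

Lemma mdeg_expon g : nneg g -> (mdeg (expon g))%:Z = tdeg g.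
Proof.
move=> /nnegP g0; rewrite mdegE /tdeg (big_morph Posz PoszD (erefl 0)).
by apply: eq_bigr => l _; rewrite mnmE gez0_abs.
Qed.

Definition embz g c : S^o := if nneg g then c *: 'X_[expon g] else 0.
Definition coefz g (p : S^o) : K^o := if nneg g then p@_(expon g) else 0.

Lemma embzB g : morphB (embz g).
Proof.
by move=> u v; rewrite /embz; case: ifP => _; rewrite ?scalerBl ?subr0.
Qed.

Lemma coefzB g : morphB (coefz g).
Proof.
by move=> u v; rewrite /coefz; case: ifP => _; rewrite ?mcoeffB ?subr0.
Qed.

Lemma coefz_mulX g k p : coefz g (mulX k (p : S^o)) = coefz (g - e k) p.
Proof.
rewrite /coefz nneg_sub /mulX; case: ifP => //= /nnegP g0.
rewrite [in LHS]/GRing.scale /= mcoeff_mulX mnmE.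
have [gk|gk] := leP 1 (g k); last first.
  by rewrite (_ : `|g k|%N == 0%N) //; have := g0 k; lia.
rewrite (_ : `|g k|%N == 0%N = false); last by lia.
have ng : nneg (g - e k) by rewrite nneg_sub gk andbT; exact/nnegP.
by rewrite (expon_sub ng) addmC addmK.
Qed.

Lemma embz_mulX g k c : nneg (g - e k) -> embz g c = mulX k (embz (g - e k) c).
Proof.
move=> ng; have := ng; rewrite nneg_sub => /andP[g0 _].
rewrite /embz g0 ng (expon_sub ng) /mulX /= mpolyXD.
by rewrite [in RHS]/GRing.scale /= scalerAr.
Qed.

Lemma coefz_embz g c : nneg g -> coefz g (embz g c) = c.
Proof. by move=> ng; rewrite /coefz /embz ng mcoeffZ mcoeffX eqxx mulr1. Qed.

Variable I : ideal S.
Hypothesis I_supp : supported I.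

Definition degset : pred G := fun g => nneg g && `[< I 'X_[expon g] >].

Lemma degset_sub g k : degset (g - e k) -> degset g.
Proof.
move=> /andP[ng /asboolP Ig]; apply/andP; split.
  by move: ng; rewrite nneg_sub => /andP[].
apply/asboolP; rewrite (expon_sub ng).
exact: ideal_monomial_up Ig (lem_addl _ _).
Qed.

Lemma degset_neg g k : g k < 0 -> ~~ degset g.
Proof.
by move=> gk; apply: contraL gk => /andP[/nnegP /(_ k)]; rewrite leNgt.
Qed.

Lemma coefz_ideal g p : I p -> degfam degset g (coefz g p).
Proof.
move=> Ip; rewrite /degfam /coefz; case: ifP => // ng /negP nm; apply/eqP.
apply: contraPT nm => pg nm; apply: nm; rewrite /degset ng; apply/asboolP.
exact: (I_supp p).1.
Qed.

Lemma embz_ideal g c : degfam degset g c -> I (embz g c).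
Proof.
move=> hc; rewrite /embz; case: ifP => ng; last exact: ideal_mem0.
have [/andP[_ /asboolP Ig]|/hc ->] := boolP (degset g); first exact: ideal_term.
by rewrite scale0r; exact: ideal_mem0.
Qed.

(** The multigraded strand in degree [b] is a direct summand of the Koszul
    complex of the ideal. *)
Lemma exact_degfam_of_ideal (Z : gfam G S^o) b (i : int) :
  (forall g u, Z g u -> I u) ->
  (forall g c, degfam degset g c -> Z g (embz g c)) ->
  exact_X Z b i -> exact_id (@degfam K n degset) b i.
Proof.
move=> ZI IZ eZ.
have H := @exact_decomposition _ _ e K^o S^o (@idops 'I_n _) (@mulX K n S^o)
  unit [:: tt] (degfam degset) (fun=> Z) (fun=> embz) (fun=> coefz) b.
apply: H => //.
- exact: degfam_subgrp.
- by move=> _; exact: embzB.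
- by move=> _; exact: coefzB.
- move=> _ k h u uh.
  have [ng|ng] := boolP (nneg (h - e k)); first exact: embz_mulX.
  by rewrite (uh _) ?(morphB0 (embzB _)) /mulX ?scaler0 // /degset (negPf ng).
- by move=> _ k h u _; rewrite coefz_mulX.
- by move=> _ g u Zu; apply: coefz_ideal; exact: ZI Zu.
- move=> d u _ ud; rewrite big_seq1.
  have [ng|ng] := boolP (nneg (b - d)); first by rewrite coefz_embz.
  rewrite (ud _) ?(morphB0 (embzB _)) ?(morphB0 (coefzB _)) //.
  by rewrite /degset (negPf ng).
Qed.

Definition homfam (j : int) : gfam G S^o :=
  fun g (u : S) => homz (j + tdeg g) u.

Lemma homfam_subgrp j : subgrp (homfam j).
Proof. by move=> g; split=> [|u v]; [exact: homz0|exact: homzB]. Qed.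

Lemma homfam_stable j : stable e (@mulX K n S^o) (homfam j).
Proof.
move=> g k u hu; apply: homz_mulX.
by have := hu; rewrite /homfam tdeg_sub addrA.
Qed.

Lemma homfam_divX j k g u : homfam j g u -> homfam j (g - e k) (divX k u).
Proof. by rewrite /homfam tdeg_sub addrA; exact: homz_divX. Qed.

Lemma exact_shift (T : zmodType) (x : 'I_n -> T -> T) (X X' : gfam G T) g h
    (i : int) : (forall d v, X (g - d) v <-> X' (h - d) v) ->
  exact_at e x X s g i -> exact_at e x X' s h i.
Proof.
move=> XX eX u Xu du; have [|w Xw dw] := eX u _ du.
  by apply: kmem_ext Xu => d v /XX.
by exists w => //; apply: kmem_ext Xw => d v /XX.
Qed.

Lemma shift_nneg d : shift e d -> forall l, 0 <= d l.
Proof.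
move=> [r ->] l; rewrite sum_ffunE; apply: sumr_ge0 => k _.
by rewrite ffunE.
Qed.

(** Conversely the part of total degree [j] is the sum of its strands; those
    with a monomial in them have degree in the box with side [|j|]. *)
Lemma exact_ideal_of_degfam j (i : int) :
  (forall b, tdeg b = j -> exact_id (@degfam K n degset) b i) ->
  exact_X (idealfam I (homfam j)) 0 i.
Proof.
move=> eb.
pose N := `|j|%N; pose D := {ffun 'I_n -> 'I_N.+1}.
pose X' (a : D) : gfam G K^o := fun g c =>
  degfam degset (boxdeg a + g) c /\ (tdeg (boxdeg a) != j -> c = 0).
pose pr (a : D) (g : G) (u : S^o) : K^o :=
  if tdeg (boxdeg a) == j then coefz (boxdeg a + g) u else 0.
pose inj (a : D) (g : G) (c : K^o) : S^o := embz (boxdeg a + g) c.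
have H := @exact_decomposition _ _ e S^o K^o (@mulX K n S^o) (@idops 'I_n _)
  D (index_enum _) (idealfam I (homfam j)) X' pr inj 0.
apply: H.
- exact: mulX_ops.
- move=> g; have [h0 hB] := homfam_subgrp j g; split=> [|u v [hu Iu] [hv Iv]].
    by split=> //; exact: ideal_mem0.
  split; first exact: hB.
  by apply: ideal_memD => //; rewrite -mulN1r; exact: ideal_memM.
- by move=> a g u v; rewrite /pr; case: ifP => _; rewrite ?coefzB ?subr0.
- by move=> a g; exact: embzB.
- by move=> a k g u _; rewrite /pr /idops coefz_mulX addrA.
- move=> a k g u [uh _]; rewrite /inj /idops addrA in uh *.
  have [ng|ng] := boolP (nneg (boxdeg a + g - e k)); first exact: embz_mulX.
  by rewrite (uh _) ?(morphB0 (embzB _)) /mulX ?scaler0 // /degset (negPf ng).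
- move=> a g u [hu Iu]; split; last by rewrite /pr => /negPf ->.
  rewrite /pr; case: ifP => // _; exact: coefz_ideal.
- move=> a g c [hc cj]; split; last exact: embz_ideal.
  have [aj|/cj ->] := eqVneq (tdeg (boxdeg a)) j; last first.
    by rewrite /inj (morphB0 (embzB _)); exact: homz0.
  rewrite /inj /embz; case: ifP => ng; last exact: homz0.
  move=> m; rewrite mcoeffZ mcoeffX.
  case: (eqVneq (expon _) m) => [<- _|_]; last by rewrite mulr0 eqxx.
  rewrite mdeg_expon // -aj /tdeg -big_split /=.
  by apply: eq_bigr => l _; rewrite ffunE.
- move=> d u /shift_nneg d0 [hu Iu]; rewrite sub0r in hu *.
  apply/mpolyP => m; rewrite (raddf_sum (mcoeff m)) /=.
  have term a : (inj a (- d) (pr a (- d) u))@_m =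
      if [&& nneg (boxdeg a - d), tdeg (boxdeg a) == j &
             expon (boxdeg a - d) == m] then u@_m else 0.
    rewrite /inj /pr /embz /coefz; case: ifP => ng; last by rewrite mcoeff0.
    rewrite mcoeffZ mcoeffX /=; case: ifP => aj; last by rewrite mul0r.
    by rewrite ng /=; case: eqP => [->|_]; rewrite ?mulr1 ?mulr0.
  rewrite (eq_bigr _ (fun a _ => term a)).
  have [um|um] := eqVneq u@_m 0.
    by rewrite um big1 // => a _; exact: if_same.
  have mj : (mdeg m)%:Z + tdeg d = j.
    rewrite (hu m um) -addrA /tdeg -big_split /= big1 ?addr0 // => l _.
    by rewrite [(- d) l]ffunE addNr.
  have mdj l : (m l)%:Z + d l <= j.
    rewrite -mj mdegE (big_morph Posz PoszD (erefl 0)) /tdeg -big_split /=.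
    rewrite (bigD1 l) //= lerDl; apply: sumr_ge0 => k _.
    by rewrite addr_ge0.
  pose a0 : D := [ffun l => inord (m l + `|d l|)%N].
  have a0E l : boxdeg a0 l = (m l)%:Z + d l.
    rewrite !ffunE inordK; first by have := d0 l; lia.
    by have := mdj l; have := d0 l; rewrite /N ltnS; lia.
  have a0d : boxdeg a0 - d = [ffun l => (m l)%:Z].
    apply/ffunP => l; have := a0E l; rewrite !ffunE => ->.
    by rewrite addrK.
  have ng0 : nneg (boxdeg a0 - d) by apply/nnegP => l; rewrite a0d ffunE.
  have aj : tdeg (boxdeg a0) = j.
    rewrite -mj mdegE (big_morph Posz PoszD (erefl 0)) /tdeg -big_split /=.
    by apply: eq_bigr => l _; rewrite a0E.
  have am : expon (boxdeg a0 - d) = m.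
    by rewrite a0d; apply/mnmP => l; rewrite !mnmE ffunE.
  rewrite (bigD1 a0) //= ng0 aj am !eqxx big1 ?addr0 // => a aa0.
  case: ifP => // /and3P[/nnegP ng _ /eqP am'].
  case/eqP: aa0; apply/ffunP => l; apply: val_inj => /=.
  have := congr1 (fun m' : 'X_{1..n} => m' l) am'; rewrite /= mnmE.
  have := ng l; have := a0E l; rewrite !ffunE => E1 E2 E3; lia.
- move=> a.
  have [aj|aj] := eqVneq (tdeg (boxdeg a)) j; last first.
    apply: exact_zero => //; last by move=> h v _ _ [_]; exact.
    move=> g; have [d0 dB] := degfam_subgrp K degset (boxdeg a + g).
    split=> [|u v [uh u0] [vh v0]]; first by split.
    by split; [exact: dB|move=> /[dup] /u0 -> /v0 ->; rewrite subrr].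
  apply: exact_shift (eb _ aj) => d v; rewrite sub0r /X' aj eqxx.
  by split=> [?|[]].
Qed.

End Multidegrees.

(** * Nonvanishing strands and generators *)

Section Betti.
Variables (K : fieldType) (n : nat).
Local Notation S := {mpoly K[n]}.
Local Notation G := (zdeg n).
Local Notation e := (@unitdeg n).
Local Notation s := (enum 'I_n).
Local Notation exact_X X := (exact_at e (@mulX K n _) X s).
Local Notation exact_deg I b i :=
  (exact_at e (@idops 'I_n _) (@degfam K n (degset I)) s b i).

Lemma tdegB (g h : G) : tdeg (g - h) = tdeg g - tdeg h.
Proof.
rewrite /tdeg -sumrB; apply: eq_bigr => l _.
by rewrite !ffunE.
Qed.

Section Proper.
Variable I : ideal S.
Hypotheses (I_supp : supported I) (I1 : ~ I 1).

Let I0 f : I f -> f@_0 = 0. Proof. exact: proper_const. Qed.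

Lemma exact_above_projdim l (i : nat) b :
  has_projective_resolution (quotmod I) l -> (l <= i)%N -> exact_deg I b i%:Z.
Proof.
move=> res li.
have eM := projective_resolution_exact (g := b) res (li : (l < i.+1)%N).
apply: (exact_degfam_of_ideal I_supp (Z := idealfam I (@allfam n S^o))).
- by move=> g u [].
- by move=> g c /embz_ideal.
apply/(exact_quotient_ideal I0) => //.
apply: exact_local eM => h v _ _; split=> // _.
by exists (quotmod_repr v); rewrite ?quotmod_reprK.
Qed.

Variable F : min_graded_resolution I.

Let gens a j : (exists k : 'I_(mgr_rank F a), mgr_deg k = j) <->
  ~ exact_X (@gradquot K n I j) 0 a%:Z.
Proof. by apply: generator_exact => z f; exact: supported_hcomp. Qed.

Let gens_ideal a j : (exists k : 'I_(mgr_rank F a.+1), mgr_deg k = j) <->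
  ~ exact_X (idealfam I (@homfam K n j)) 0 a%:Z.
Proof.
rewrite gens -(exact_quotient_ideal I0 (@homfam_subgrp K n j)
  (@homfam_stable K n j)) //.
exact: homfam_divX.
Qed.

Lemma generator_multidegree a (k : 'I_(mgr_rank F a.+1)) :
  exists2 b, tdeg b = mgr_deg k & ~ exact_deg I b a%:Z.
Proof.
apply: contrapT => nb; have /gens_ideal : exists k' : 'I_(mgr_rank F a.+1),
  mgr_deg k' = mgr_deg k by exists k.
apply; apply: exact_ideal_of_degfam => // b bk.
by apply: contrapT => neb; apply: nb; exists b.
Qed.

Lemma multidegree_generator a b : ~ exact_deg I b a%:Z ->
  exists k : 'I_(mgr_rank F a.+1), mgr_deg k = tdeg b.
Proof.
move=> neb; apply/gens_ideal => eI; apply: neb.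
apply: (exact_degfam_of_ideal I_supp (Z := idealfam I (@homfam K n 0))).
- by move=> g u [].
- move=> g c gc; split; last exact: embz_ideal.
  rewrite /homfam /embz; case: ifP => ng; last exact: homz0.
  move=> m; rewrite mcoeffZ mcoeffX add0r.
  case: (eqVneq (expon _) m) => [<- _|_]; first exact: mdeg_expon.
  by rewrite mulr0 eqxx.
apply: exact_shift eI => d v; rewrite /idealfam /homfam !tdegB.
by rewrite (tdeg0 n) sub0r add0r.
Qed.

Let piB : @morphB S^o (quotmod I) (quotmod_pi I).
Proof. exact: quotmod_piB. Qed.

Lemma generator0 : exists k : 'I_(mgr_rank F 0), mgr_deg k = 0.
Proof.
apply/gens => eX.
have sX : subgrp (@gradquot K n I 0).
  move=> g; split; first by exists 0; [exact: homz0|rewrite (morphB0 piB)].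
  move=> _ _ [u hu ->] [v hv ->]; exists (u - v); first exact: homzB.
  by rewrite -piB.
have [xB _] := mulX_ops (quotmod I).
have [||w Xw dw] := eX (kone s (quotmod_pi I 1)).
- apply/kmem0P => //; exists (quotmod_pi I 1) => //; exists 1 => // m.
  rewrite mcoeff1 (tdeg0 n).
  by have [->|] := eqVneq m 0%MM; rewrite ?mdeg0 ?eqxx.
- exact: kd_kone.
have [|y Xy yE] := @kone_bound_out _ _ e _ (@mulX K n _) _ s 0
    (quotmod_pi I 1) sX xB (enum_uniq 'I_n).
  by exists w; [exact: Xw|exact: dw].
have /choice [f fE] : forall l, exists f : S, y l = quotmod_pi I f.
  by move=> l; have [f _ yl] := Xy l; exists f.
have : quotmod_pi I 1 = quotmod_pi I (\sum_(l <- s) 'X_l * f l).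
  rewrite quotmod_pi_sum yE; apply: eq_bigr => l _.
  by rewrite fE /mulX quotmod_piZ.
move=> /quotmod_piP /I0 /eqP; rewrite mcoeffB mcoeff1 eqxx.
rewrite (raddf_sum (mcoeff _)) big1 ?subr0 ?oner_eq0 // => l _.
by rewrite /= mcoeff_mulX mnm0E.
Qed.

Lemma generator0_deg (k : 'I_(mgr_rank F 0)) : mgr_deg k = 0.
Proof.
apply: contrapT => /eqP k0; have /gens : exists k' : 'I_(mgr_rank F 0),
  mgr_deg k' = mgr_deg k by exists k.
apply=> z Zz _.
have /kmem0P [|v [u hu ->] ->] := Zz.
  move=> g; split; first by exists 0; [exact: homz0|rewrite (morphB0 piB)].
  move=> _ _ [u hu ->] [v hv ->]; exists (u - v); first exact: homzB.
  by rewrite -piB.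
have [||w Yw dw] := division_boundary (divX_division K n)
  (@homfam_subgrp K n (mgr_deg k)) (@homfam_stable K n (mgr_deg k)) _ hu.
- by move=> l g p; exact: homfam_divX.
- apply: remainder_eq0; apply: homz_const hu _.
  by rewrite (tdeg0 n) addr0.
exists (kmap e (fun=> quotmod_pi I : S^o -> quotmod I) 0 w).
  apply: kmap_kmem Yw => [h|h t Yt]; first exact: (morphB0 piB).
  by exists t.
rewrite -(@kmap_kd _ _ e S^o (quotmod I) (@mulX K n _)
  (fun=> quotmod_pi I) (@mulX K n S^o)) ?dw ?kmap_kone //.
by move=> l h t _; rewrite /mulX quotmod_piZ.
Qed.

End Proper.

Section Restricted.
Variables (I : ideal S) (alpha : 'X_{1..n}).
Local Notation J := (ideal_le I alpha).

Lemma degset_ideal_leP (g : G) : degset J g <->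
  nneg g /\ exists b, [/\ I 'X_[b], (b <= alpha)%MM & (b <= expon g)%MM].
Proof.
rewrite /degset; split=> [/andP[-> /asboolP /ideal_le_monomialP]//|[-> h]].
exact/asboolP/ideal_le_monomialP.
Qed.

(** If [c] exceeds [alpha] in the variable [k], then in the degrees of the
    strand division by [k] keeps a monomial in the ideal. *)
Lemma exact_ideal_le_vanish (c : G) (i : int) :
  ~ (forall l, c l <= (alpha l)%:Z) -> exact_deg J c i.
Proof.
move=> /existsNP[k /negP]; rewrite -ltNge => ck.
apply: (@exact_cone_iso n K^o (degfam (degset J)) _ _ k);
  rewrite ?enum_uniq ?mem_enum //.
- exact: degfam_subgrp.
- by apply: degfam_stable => g l; exact: degset_sub.
move=> h v hk hv nh; apply: hv; apply: contra nh.
move=> /degset_ideal_leP[ng [b [Ib ba bh]]]; apply/degset_ideal_leP.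
have nk : nneg (h - e k) by rewrite nneg_sub ng hk; lia.
split=> //; exists b; split=> //; apply/mnm_lepP => l; rewrite mnmE.
have /mnm_lepP /(_ l) := bh; rewrite mnmE.
have [->|lk] := eqVneq l k; last by rewrite sub_unitdeg_ne.
have /mnm_lepP /(_ k) := ba; rewrite sub_unitdeg_id hk; lia.
Qed.

Lemma exact_ideal_le (c : G) (i : int) : (forall l, c l <= (alpha l)%:Z) ->
  exact_deg J c i <-> exact_deg I c i.
Proof.
move=> ca.
have JI (h : G) : (forall l, h l <= c l) -> degset J h = degset I h.
  move=> hc; apply/idP/idP.
    move=> /degset_ideal_leP[ng [b [Ib ba bh]]]; rewrite /degset ng.
    by apply/asboolP; exact: ideal_monomial_up bh.
  move=> /andP[ng /asboolP Ih]; apply/degset_ideal_leP; split=> //.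
  exists (expon h); split=> //; last exact: lepm_refl.
  apply/mnm_lepP => l; rewrite mnmE.
  by have := hc l; have := ca l; have /nnegP /(_ l) := ng; lia.
by split; apply: exact_local => h v hc _; rewrite /degfam JI.
Qed.

Lemma degset_ideal_le_cap (N : nat) (g : G) : (forall l, (alpha l <= N)%N) ->
  degset J g = degset J [ffun l => Num.min (g l) N%:Z].
Proof.
move=> aN; set h := finfun _.
have hE l : h l = Num.min (g l) N%:Z by rewrite ffunE.
have nE : nneg h = nneg g.
  apply/nnegP/nnegP => ng l; have := ng l; rewrite hE; lia.
apply/idP/idP => /degset_ideal_leP[ng [b [Ib ba bg]]]; apply/degset_ideal_leP.
  split; first by rewrite nE.
  exists b; split=> //; apply/mnm_lepP => l; rewrite mnmE hE.
  have /mnm_lepP /(_ l) := ba; have /mnm_lepP /(_ l) := bg; rewrite mnmE.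
  by have := aN l; have /nnegP /(_ l) := ng; lia.
rewrite nE in ng; split=> //.
exists b; split=> //; apply/mnm_lepP => l; rewrite mnmE.
have /mnm_lepP /(_ l) := bg; rewrite mnmE hE.
by have /nnegP /(_ l) := ng; lia.
Qed.

End Restricted.
End Betti.

(** * Subadditivity *)

Section ProjdimFacts.
Variable R : nzRingType.

Lemma projdim_le (M : lmodType R) l :
  has_projective_resolution M l -> (projdim M <= (l%:Z)%:E)%E.
Proof.
move=> res; rewrite /projdim; case: ifP => _; first exact: leNye.
case: pselect => [ex|[]]; last by exists l; apply/asboolP.
rewrite lee_fin lez_nat; case: ex_minnP => m _; apply; exact/asboolP.
Qed.

Lemma projdimP (M : lmodType R) : ~ (forall x : M, x = 0) ->
  (exists2 l : nat, projdim M = (l%:Z)%:E & has_projective_resolution M l) \/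
  projdim M = +oo%E.
Proof.
move=> nz; rewrite /projdim; case: asboolP => // _.
case: pselect => [ex|_]; last by right.
by left; case: ex_minnP => m /asboolP res _; exists m.
Qed.

Lemma projdim_zero (M : lmodType R) : (forall x : M, x = 0) ->
  projdim M = -oo%E.
Proof. by move=> z; rewrite /projdim asboolT. Qed.

Lemma row_projective r : projective 'rV[R]_r.
Proof.
move=> M N f g onto.
have /choice [m fm] : forall k : 'I_r, exists m, f m = g (delta_mx 0 k).
  by move=> k; exact: onto.
pose h (v : 'rV[R]_r) : M := \sum_k v 0 k *: m k.
have hL : linear h.
  move=> c u v; rewrite scaler_sumr -big_split; apply: eq_bigr => k _ /=.
  by rewrite !mxE scalerDl scalerA.
pose H := GRing.isLinear.Build R 'rV[R]_r M _ h hL.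
exists (HB.pack h H : {linear 'rV[R]_r -> M}) => v /=.
rewrite [in RHS](row_sum_delta v) !linear_sum; apply: eq_bigr => k _.
by rewrite !linearZ fm.
Qed.

End ProjdimFacts.

Lemma finite_maximum (A : \bar int -> Prop) (r : seq (\bar int)) :
  (forall x, A x -> x \in r) -> (exists x, A x) -> exists m, is_maximum A m.
Proof.
elim: r A => [|y r IH] A sub [x Ax]; first by have := sub x Ax.
have [[z [Az zy]]|none] := pselect (exists z, A z /\ z != y).
  have [||m [[Am my] mmax]] := IH (fun z => A z /\ z != y).
  - by move=> w [/sub]; rewrite inE => /orP[/eqP ->|//]; rewrite eqxx.
  - by exists z.
  have [Ay|nAy] := pselect (A y).
    exists (maxe m y); split; first by rewrite maxEle; case: ifP.
    move=> w Aw; rewrite le_max; have [->|wy] := eqVneq w y.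
      by rewrite lexx orbT.
    by rewrite mmax.
  exists m; split=> // w Aw; apply: mmax; split=> //.
  by apply: contra_notN nAy => /eqP <-.
have Ey w : A w -> w = y.
  by move=> Aw; apply: contrapT => /eqP wy; apply: none; exists w.
by exists y; split=> [|w /Ey ->//]; rewrite -(Ey x Ax).
Qed.

Section QuotientZero.
Variables (K : fieldType) (n : nat).
Implicit Type I : ideal {mpoly K[n]}.

Lemma quotmod_zeroP I : (forall x : quotmod I, x = 0) <-> I 1.
Proof.
split=> [z|I1 x].
  have /quotmod_piP : quotmod_pi I 1 = quotmod_pi I 0.
    exact: etrans (z _) (esym (z _)).
  by rewrite subr0.
have <- : quotmod_pi I 0 = 0 by exact: morphB0 (@quotmod_piB K n I).
rewrite -(quotmod_reprK x).
apply/quotmod_piP; rewrite subr0.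
by have := ideal_memM (quotmod_repr x) I1; rewrite mulr1.
Qed.

Local Notation exact_deg I b i :=
  (exact_at (@unitdeg n) (@idops 'I_n _) (@degfam K n (degset I))
     (enum 'I_n) b i).

Lemma projdim_gt I b (i : nat) : supported I -> ~ I 1 -> ~ exact_deg I b i%:Z ->
  ((i.+1%:Z)%:E <= projdim (quotmod I))%E.
Proof.
move=> sI I1 nex; have [|[l -> res]|->] := @projdimP _ (quotmod I).
- by move/quotmod_zeroP.
- rewrite lee_fin lez_nat ltnNge; apply/negP => li; apply: nex.
  exact: exact_above_projdim res li.
- exact: leey.
Qed.

Lemma projdim_ge0 I : ~ I 1 -> (0%:E <= projdim (quotmod I))%E.
Proof.
move=> I1; have [|[l -> _]|->] := @projdimP _ (quotmod I).
- by move/quotmod_zeroP.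
- by rewrite lee_fin.
- exact: leey.
Qed.

Lemma exact_deg_neg I (c : zdeg n) (i : int) l : c l < 0 -> exact_deg I c i.
Proof.
move=> cl; apply: exact_zero => //; first exact: degfam_subgrp.
move=> h v hc _; apply; apply: (@degset_neg _ _ _ _ l).
exact: le_lt_trans (hc l) cl.
Qed.

End QuotientZero.

Section Shifts.
Variables (K : fieldType) (n : nat) (I : ideal {mpoly K[n]}).
Hypothesis hI : monomial_ideal I.
Variables (alpha beta : 'X_{1..n}).
Hypothesis hcov : covering_pair I alpha beta.
Hypothesis I1 : ~ I 1.
Variable F : min_graded_resolution I.
Local Notation J := (ideal_le I alpha).
Local Notation L := (ideal_le I beta).
Local Notation exact_deg I b i :=
  (exact_at (@unitdeg n) (@idops 'I_n _) (@degfam K n (degset I))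
     (enum 'I_n) b i).

Let J1 : ~ J 1. Proof. by move/ideal_le_sub. Qed.
Let L1 : ~ L 1. Proof. by move/ideal_le_sub. Qed.

Lemma degset_cover g : degset I g = predU (degset J) (degset L) g.
Proof.
rewrite /degset /= -andb_orr; congr (_ && _); apply/asboolP/orP.
  by move/(covering_monomialP _ hcov) => [h|h]; [left|right]; exact/asboolP.
by move=> h; apply/(covering_monomialP _ hcov); case: h => /asboolP; [left|right].
Qed.

Lemma restricted_generator gam c (i : nat) :
  ~ exact_deg (ideal_le I gam) c i%:Z ->
  [/\ forall l, 0 <= c l,
      ((i.+1%:Z)%:E <= projdim (quotmod (ideal_le I gam)))%E &
      exists k : 'I_(mgr_rank F i.+1), mgr_deg k = tdeg c].
Proof.
move=> nex; split.
- move=> l; rewrite leNgt; apply/negP => cl; apply: nex; exact: exact_deg_neg cl.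
- apply: projdim_gt nex; first exact: ideal_le_supported.
  by move/ideal_le_sub.
apply: multidegree_generator => //; first exact: monomial_supported.
move=> eI; apply: nex.
have [ca|] := pselect (forall l, c l <= (gam l)%:Z); last first.
  exact: exact_ideal_le_vanish.
exact/exact_ideal_le.
Qed.

(** A class of one of the two restricted ideals is paired with the generator in
    homological degree 0, of degree 0; a class of their intersection gives two
    generators in positive homological degrees. *)
Lemma generator_split a (k : 'I_(mgr_rank F a)) : exists i j : nat,
  [/\ (i + j)%N = a, ((i%:Z)%:E <= projdim (quotmod J))%E,
      ((j%:Z)%:E <= projdim (quotmod L))%E &
      exists (k1 : 'I_(mgr_rank F i)) (k2 : 'I_(mgr_rank F j)),
        mgr_deg k <= mgr_deg k1 + mgr_deg k2].
Proof.
have sI := monomial_supported hI.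
have [k0 k0E] := generator0 sI I1 F.
have J0 := projdim_ge0 J1; have L0 := projdim_ge0 L1.
case: a k => [|a] k.
  exists 0%N, 0%N; split; [by []|exact: J0|exact: L0|exists k0, k0].
  by rewrite k0E (generator0_deg sI).
have [b bk nexb] := generator_multidegree sI I1 k.
have [eJ|/restricted_generator[_ aJ _]] :=
    pselect (exact_deg J b a%:Z); last first.
  exists a.+1, 0%N; split; [exact: addn0|exact: aJ|exact: L0|].
  by exists k, k0; rewrite k0E addr0.
have [eL|/restricted_generator[_ aL _]] :=
    pselect (exact_deg L b a%:Z); last first.
  exists 0%N, a.+1; split; [by []|exact: J0|exact: aL|].
  by exists k0, k; rewrite k0E add0r.
have [[i [j [c [d [ija cd nJ nL]]]]]|none] :=
  pselect (exists (i j : nat) (c d : zdeg n),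
    [/\ (i + j).+1 = a, forall l, Num.max (c l) (d l) = b l,
        ~ exact_deg J c i%:Z & ~ exact_deg L d j%:Z]).
  have [c0 iJ [k1 k1E]] := restricted_generator nJ.
  have [d0 jL [k2 k2E]] := restricted_generator nL.
  exists i.+1, j.+1; split; [by rewrite addSn addnS ija|exact: iJ|exact: jL|].
  exists k1, k2; rewrite -bk k1E k2E /tdeg -big_split /=.
  by apply: ler_sum => l _; rewrite -cd ge_max lerDl lerDr d0 c0.
case: nexb; apply: (exact_local (X := degfam (predU (degset J) (degset L)))).
  by move=> h v _ _; rewrite /degfam degset_cover.
(* The total degree of [beta] bounds each of its entries. *)
pose N := mdeg beta.
apply: (@exact_union K n (degset J) (degset L) _ _ _ _ N) eJ eL.
- by move=> g l; exact: degset_sub.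
- by move=> g l; exact: degset_sub.
- by move=> g l; exact: degset_neg.
- by move=> g l; exact: degset_neg.
- move=> g; apply: degset_ideal_le_cap => l.
  by rewrite /N mdegE (bigD1 l) //= leq_addr.
move=> i j c d ija cd; apply: contrapT => /not_orP[nJ nL].
by apply: none; exists i, j, c, d.
Qed.

Lemma projdim_cover :
  (projdim (quotmod I) <= projdim (quotmod J) + projdim (quotmod L))%E.
Proof.
have nzJ : ~ forall x : quotmod J, x = 0 by move/quotmod_zeroP.
have nzL : ~ forall x : quotmod L, x = 0 by move/quotmod_zeroP.
have [[p pE _]|->] := projdimP nzJ; last first.
  by rewrite addye ?leey //; apply: contraTneq (projdim_ge0 L1) => ->.
have [[q qE _]|->] := projdimP nzL; last by rewrite addey ?leey // pE.
rewrite pE qE -EFinD -PoszD; apply: projdim_le.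
exists (fun a => 'rV[{mpoly K[n]}]_(mgr_rank F a)).
exists (fun a => mulmxr (mgr_diff F a)), (mgr_aug F).
split; [by move=> a; exact: row_projective|exact: mgr_resolution|].
move=> a pqa x; apply/rowP => k.
have [i [j [ija ip jq _]]] := generator_split k.
by move: ip jq; rewrite pE qE !lee_fin !lez_nat; lia.
Qed.

End Shifts.

Theorem theorem5 (K : fieldType) (n : nat) (I : ideal {mpoly K[n]})
    (hI : monomial_ideal I) (alpha beta : 'X_{1..n})
    (hcov : covering_pair I alpha beta) (p q : \bar int)
    (hp : p = projdim (quotmod (ideal_le I alpha)))
    (hq : q = projdim (quotmod (ideal_le I beta)))
    (F : min_graded_resolution I) :
  (projdim (quotmod I) <= p + q)%E /\
  (forall a : int, (a%:E <= projdim (quotmod I))%E ->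
     exists2 m : \bar int,
       is_maximum
         (fun x => exists i j : int,
            [/\ i + j = a, (i%:E <= p)%E, (j%:E <= q)%E &
                x = (t_ F i + t_ F j)%E]) m &
       (t_ F a <= m)%E).
Proof.
have [I1|I1] := pselect (I 1).
  rewrite projdim_zero; last exact/quotmod_zeroP.
  by split=> [|a]; [exact: leNye|rewrite leeNy_eq].
have pq : (projdim (quotmod I) <= p + q)%E.
  by rewrite hp hq; exact: projdim_cover.
split=> // a apd; have apq := le_trans apd pq.
pose A (x : \bar int) := exists i j : int,
  [/\ i + j = a, (i%:E <= p)%E, (j%:E <= q)%E & x = (t_ F i + t_ F j)%E].
have p0 : (0%:E <= p)%E by rewrite hp; apply: projdim_ge0 => /ideal_le_sub.
have q0 : (0%:E <= q)%E by rewrite hq; apply: projdim_ge0 => /ideal_le_sub.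
have exA : exists x, A x.
  have [i [j [ija ip jq]]] : exists i j : int,
      [/\ i + j = a, (i%:E <= p)%E & (j%:E <= q)%E].
    move: p0 q0 apq {hp hq pq A}; case: p => [p| |]; case: q => [q| |] // _ _.
    (* The witness spends as much of [p] as possible; [a - p] may be negative
       and then contributes the value -oo. *)
    - rewrite -EFinD lee_fin => apq; exists p, (a - p).
      by rewrite subrKC !lee_fin lexx lerBlDl.
    - by exists p, (a - p); rewrite subrKC lexx leey.
    - by exists (a - q), q; rewrite subrK lexx leey.
    - by exists a, 0; rewrite addr0 !leey.
  by exists (t_ F i + t_ F j)%E, i, j.
have [m mmax] : exists m, is_maximum A m.
  pose r (b : nat) := -oo%E ::
    [seq (t_ F (Posz i) + t_ F (a - Posz i))%E | i <- iota 0 b.+1].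
  apply: (@finite_maximum _ (r `|a|%N)) => // x [i [j [ija _ _ ->]]].
  case: i ija => i ija; last by rewrite /= addNye mem_head.
  case: j ija => j ija; last by rewrite /= addeNy mem_head.
  rewrite inE; apply/orP; right; apply/mapP; exists i.
    by rewrite mem_iota -ija; lia.
  by congr (_ + t_ F _)%E; lia.
exists m => //; have [_ mub] := mmax.
case: a @A {apd apq exA} m {mmax} mub => [a|a] A m mub; last exact: leNye.
rewrite /t_; elim/big_ind: _ => [|x y xm ym|k _]; first exact: leNye.
  by rewrite ge_max xm ym.
have [i [j [ija ip jq [k1 [k2 kk]]]]] := generator_split hI hcov I1 k.
apply: (@le_trans _ _ (t_ F i%:Z + t_ F j%:Z)%E); last first.
  apply: mub; exists i%:Z, j%:Z; split; last by [].
  - by rewrite -PoszD ija.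
  - by rewrite hp; exact: ip.
  - by rewrite hq; exact: jq.
have t1 : ((mgr_deg k1)%:E <= t_ F i%:Z)%E by exact: le_bigmax.
have t2 : ((mgr_deg k2)%:E <= t_ F j%:Z)%E by exact: le_bigmax.
by apply: le_trans (leeD t1 t2); rewrite -EFinD lee_fin.
Qed.
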